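(* Assume: (a) $c\ge 1$ and $\alpha\ge1$ are fixed constants, and $(n,p,k)\to\infty$ with $p/n^{\alpha}\to c$; (b) the signal strength $\beta>0$, either fixed or growing with $n,p$, satisfies $\beta\le\sqrt{p/n}$; (c) the sparsity level $k$ satisfies $k\ge 2p/\sqrt n$, and $k/p\to0$. Then there exists $\zeta=\zeta(n)\to0$ such that, with probability tending to one as $(n,p,k)\to\infty$, every solution $X$ of the semidefinite program $$\operatorname{argmax}\{\langle\hat\Sigma,X\rangle : X\in\mathcal S^p_+,\ \operatorname{tr}(X)=1,\ \|X\|_S\le k\}$$ satisfies $$(1-\zeta)\Bigl(1+\frac pn\Bigr)\le\langle\hat\Sigma,X\rangle\le(1+\zeta)\Bigl(1+\sqrt{\frac pn}+\sqrt\beta\Bigr)^2.$$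
   Context: Single-spike model: the spike $\mathbf z\in\mathbb R^p$ is a deterministic unit-length vector with exactly $k$ nonzero entries, each equal to $+1/\sqrt k$ or $-1/\sqrt k$. The samples are $\mathbf x_i=\sqrt{\beta}\,u_i\,\mathbf z+\boldsymbol\xi_i$ for $i=1,\dots,n$, where $\beta>0$ is the signal strength, $u_i\sim N(0,1)$, the vectors $\boldsymbol\xi_i\in\mathbb R^p$ have i.i.d. $N(0,1)$ entries, and all the $u_i$'s and $\boldsymbol\xi_i$'s are mutually independent. The sample covariance matrix is $\hat\Sigma=\frac1n\sum_{i=1}^n\mathbf x_i\mathbf x_i^T$. For $p\times p$ real matrices, $\langle A,B\rangle=\sum_{i,j}A_{ij}B_{ij}=\operatorname{tr}(A^TB)$, $\|X\|_S=\sum_{i,j}|X_{ij}|$, and $\mathcal S^p_+$ is the cone of symmetric positive semidefinite $p\times p$ matrices. The parameter $k$ in the semidefinite program equals the sparsity of the spike. Asymptotic statements refer to sequences $p=p(n)$, $k=k(n)$ with $n\to\infty$, $p\to\infty$, $k\to\infty$. *)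

(* Defs.v *)
(* MathComp / MathComp-Analysis *)
From HB Require Import structures.
From mathcomp Require Import all_boot all_order all_algebra.
From mathcomp Require Import all_classical all_reals all_analysis.

Set Implicit Arguments.
Unset Strict Implicit.
Unset Printing Implicit Defensive.

Import Order.TTheory GRing.Theory Num.Theory.
Import numFieldNormedType.Exports.

Local Open Scope classical_set_scope.
Local Open Scope ring_scope.

Section probability_notions.
Context {R : realType}.

Definition mutually_independent d (T : measurableType d) (P : probability T R)
    (I : finType) (Y : I -> {RV P >-> R}) : Prop :=
  forall (J : {set I}) (B : I -> set R), (forall i, measurable (B i)) ->
    P (\bigcap_(i in [set` J]) (Y i @^-1` B i)) =
    (\prod_(i in J) P (Y i @^-1` B i))%E.

(* The value of a measure on a non-measurable set carries no information in the
   library, so "E n holds with probability tending to one" is stated with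
   measurable events inside E n; for measurable E n this is P n (E n) --> 1. *)
Definition with_probability_tending_to_one (d : nat -> measure_display)
    (T : forall n, measurableType (d n)) (P : forall n, probability (T n) R)
    (E : forall n, set (T n)) : Prop :=
  exists A : forall n, set (T n),
    [/\ forall n, measurable (A n),
        forall n, A n `<=` E n
      & P n (A n) @[n --> \oo] --> 1%E].

End probability_notions.

Section spike_model.
Context {R : realType}.

Definition is_spike (p k : nat) (z : 'cV[R]_p) : Prop :=
  [/\ \sum_i z i 0 ^+ 2 = 1,
      #|[pred i | z i 0 != 0]| = k
    & forall i, z i 0 != 0 ->
        z i 0 = (Num.sqrt k%:R)^-1 \/ z i 0 = - (Num.sqrt k%:R)^-1].

Context d (T : measurableType d) (P : probability T R) (n p : nat).
Variables (u : 'I_n -> {RV P >-> R}) (xi : 'I_n -> 'I_p -> {RV P >-> R}).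

Definition latent_variable (l : 'I_n + 'I_n * 'I_p) : {RV P >-> R} :=
  match l with
  | inl i => u i
  | inr ij => xi ij.1 ij.2
  end.

Definition iid_standard_normal_latents : Prop :=
  (forall l, distribution P (latent_variable l) = normal_prob 0 1 :> (set R -> \bar R)) /\
  mutually_independent latent_variable.

Definition sample (beta : R) (z : 'cV[R]_p) (i : 'I_n) (w : T) : 'cV[R]_p :=
  (Num.sqrt beta * u i w) *: z + \col_j xi i j w.

Definition sample_covariance (beta : R) (z : 'cV[R]_p) (w : T) : 'M[R]_p :=
  n%:R^-1 *: \sum_i sample beta z i w *m (sample beta z i w)^T.

End spike_model.

Section semidefinite_program.
Context {R : realType} (p : nat).
Implicit Types A B X : 'M[R]_p.

Definition mxdot A B : R := \sum_i \sum_j A i j * B i j.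

Definition entry_norm1 X : R := \sum_i \sum_j `|X i j|.

Definition psd X : Prop :=
  X^T = X /\ forall v : 'cV[R]_p, 0 <= (v^T *m X *m v) 0 0.

Definition sdp_feasible (k : nat) X : Prop :=
  [/\ psd X, \tr X = 1 & entry_norm1 X <= k%:R].

Definition sdp_solution (k : nat) A X : Prop :=
  sdp_feasible k X /\ forall Y, sdp_feasible k Y -> mxdot A Y <= mxdot A X.

End semidefinite_program.

(* Main.v *)
(** Write [Y = G + sqrt beta z u^T] for the data matrix and [M = G G^T] for the
    noise part, so that the sample covariance is [Y Y^T / n].

    Upper bound.  For [X] positive semidefinite of trace 1, [sqrt <Y Y^T, X>] is
    a seminorm in [Y], at most [sqrt <M, X> + sqrt beta |u|], and Cauchy-Schwarz
    gives [<M, X>^K <= tr M^K] whenever [K] is a power of two.  The sharp constant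
    comes from the moment method.  Gaussian integration by parts yields a
    recursion for the expectations of products of traces of powers of [M]; its
    non-planar terms are absorbed by [tr M^(k+l) <= tr M^k tr M^l].  Hence these
    expectations are dominated by products of a Catalan-like sequence in which
    [n + p] and [p n] are merely replaced by [n + p + 3K] and [p n + 2K], and whose
    growth rate is [(sqrt n + sqrt p)^2 + O(K)].  Markov's inequality with [K] of
    order [sqrt n] concludes.

    Lower bound.  The same recursion gives the first two moments of [tr M] and
    [tr M^2], which therefore concentrate.  By Cauchy-Schwarz, so does the
    entrywise norm of [M / tr M], which makes it feasible because
    [k >= 2 p / sqrt n]; its value is about [tr M^2 / (n tr M)], that is
    [1 + p / n], the spike contributing a negligible cross term. *)

Require Import Defs.
From HB Require Import structures.
From mathcomp Require Import all_boot all_order all_algebra.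
From mathcomp Require Import all_classical all_reals all_analysis.
From mathcomp Require Import measurable_realfun.
From mathcomp Require Import(canonicals,coercions) mpoly.
From mathcomp Require Import ring lra zify.

Set Implicit Arguments.
Unset Strict Implicit.
Unset Printing Implicit Defensive.

Import Order.TTheory GRing.Theory Num.Theory.
Import numFieldNormedType.Exports.

Local Open Scope classical_set_scope.
Local Open Scope ring_scope.

(** * Independence and standard normal moments *)

(** The recursion does not close on single traces: integrating one trace by parts splits it in two,
    and the expectation of a product does not factor. The induction therefore runs over lists of
    traces ordered by total degree, and [K] bounds that degree throughout, so that one majorant
    sequence serves every list. All variables are polynomials in the Gaussian entries, which makes
    integrability automatic and reduces integration by parts to monomials. Frobenius norms and
    Cauchy-Schwarz stand in for spectral arguments.

    The size of [K] is constrained from both sides: the error O(K) at the edge must be small against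
    [n], while [(1 + eps)^K] must beat a square root of order [sqrt (p n)], which is polynomial in
    [n] because [p / n^alpha] converges.

    Feasibility has room to spare: the bound on the entrywise norm of [M / tr M] is about
    [1 + p / sqrt n], and the constraint allows twice the leading term. The cross term is small
    because [beta <= sqrt (p / n)] makes [beta |u|^2] at most of order [sqrt (p n)], against a
    Frobenius norm of [M] of order at least [p sqrt n]. All estimates hold at a fixed accuracy;
    [zeta] comes from a diagonal choice. *)

Section density.
Import HBNNSimple.

(** The hypothesis on indicators says that [nu] is the image under [phi] of the measure with density
    [h]; simple functions and monotone convergence do the rest. It is used with [h] the product of
    the remaining independent factors, and with [h] the normal density. *)
Lemma ge0_integral_density d d' (T : measurableType d) (T' : measurableType d')
    (R : realType) (mu : {measure set T -> \bar R})
    (nu : {measure set T' -> \bar R}) (phi : T -> T') (h : T -> R) (f : T' -> R) :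
  measurable_fun setT phi -> measurable_fun setT h -> (forall x, 0 <= h x) ->
  (forall B, measurable B ->
     (\int[mu]_x (\1_B (phi x) * h x)%:E = nu B)%E) ->
  measurable_fun setT f -> (forall y, 0 <= f y) ->
  (\int[mu]_x (f (phi x) * h x)%:E = \int[nu]_y (f y)%:E)%E.
Proof.
move=> mphi mh h0 muE mf f0.
have mF : measurable_fun setT (EFin \o f) by exact/measurable_EFinP.
pose f_ := nnsfun_approx measurableT mF.
have F0 (x : T') : [set: T'] x -> (0 <= (EFin \o f) x)%E by rewrite /= lee_fin.
transitivity (limn (fun n => \int[nu]_y (f_ n y)%:E)%E); last first.
  rewrite -monotone_convergence//.
  - apply: eq_integral => y _; apply/cvg_lim => //.
    exact: (@cvg_nnsfun_approx _ _ _ _ measurableT _ mF).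
  - by move=> n; exact/measurable_EFinP.
  - by move=> n y _; rewrite lee_fin.
  - by move=> y _ m n mn; rewrite lee_fin; exact/lefP/nd_nnsfun_approx.
rewrite [X in limn X](_ : _ =
    (fun n => \int[mu]_x (f_ n (phi x) * h x)%:E)%E).
  rewrite -monotone_convergence//; last 3 first.
  - move=> n; apply/measurable_EFinP/measurable_funM => //.
    exact: measurableT_comp.
  - by move=> n x _; rewrite lee_fin mulr_ge0.
  - move=> x _ m n mn; rewrite lee_fin ler_wpM2r//.
    exact/lefP/nd_nnsfun_approx.
  apply: eq_integral => x _; apply/esym/cvg_lim => //.
  rewrite EFinM; under eq_fun do rewrite EFinM.
  apply: cvgeZr => //.
  exact: (@cvg_nnsfun_approx _ _ _ _ measurableT _ mF).
apply/funext => n.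
transitivity (\sum_(k \in range (f_ n)) (k%:E * nu (f_ n @^-1` [set k])))%E.
  under eq_integral do rewrite fimfunE -fsumEFin//.
  rewrite ge0_integral_fsum//; last 2 first.
  - by move=> y; exact/measurable_EFinP/measurable_funM.
  - by move=> y x _; rewrite nnfun_muleindic_ge0.
  apply: eq_fsbigr => r _; rewrite integralZl_indic_nnsfun//.
  by rewrite integral_indic// setIT.
rewrite (_ : \int[mu]_x _ = \int[mu]_x (\sum_(k \in range (f_ n))
    (k * \1_(f_ n @^-1` [set k]) (phi x) * h x)%:E))%E; last first.
  apply: eq_integral => x _; rewrite fsumEFin//; congr EFin.
  by rewrite {1}fimfunE fsbig_finite//= [RHS]fsbig_finite//= big_distrl.
have mI (k : R) : measurable_fun setT
    (fun x => \1_(f_ n @^-1` [set k]) (phi x) * h x).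
  by apply: measurable_funM => //; apply: measurableT_comp.
have I0 k x : 0 <= \1_(f_ n @^-1` [set k]) (phi x) * h x :> R.
  by rewrite mulr_ge0.
rewrite ge0_integral_fsum//; last 2 first.
- by move=> k; under eq_fun do rewrite -mulrA; exact/measurable_EFinP/measurable_funM.
- move=> k x _; rewrite EFinM mule_ge0//; last by rewrite lee_fin.
  by rewrite nnfun_muleindic_ge0.
apply: eq_fsbigr => k; rewrite inE => -[y _ <-{k}].
under eq_integral do rewrite -mulrA EFinM.
rewrite ge0_integralZl//.
- by rewrite muE.
- apply/measurable_EFinP/measurable_funM => //.
  exact: measurableT_comp.
- by move=> x _; rewrite lee_fin mulr_ge0.
- by rewrite lee_fin.
Qed.

End density.

(** * Expectations of products of functions of independent variables *)

Section independent_products.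
Context d (T : measurableType d) (R : realType) (P : probability T R).
Context (I : finType) (Y : I -> {RV P >-> R}).
Hypothesis Y_indep : mutually_independent Y.

Let P_indic A : measurable A -> P A = (\int[P]_w (\1_A w)%:E)%E.
Proof. by move=> mA; rewrite integral_indic// setIT. Qed.

(** Induction on the list [s] of indices where [g] may be arbitrary; elsewhere [g] is an indicator.
    For empty [s] this is independence itself. To free one more index [i], the product of the other
    factors is taken as a density: the induction hypothesis, with [g i] replaced by an indicator,
    shows that its image under [Y i] is a multiple of the law of [Y i]. *)
Let ge0_expectation_prod_aux (s : seq I) (g : I -> R -> R) (m : I -> R) :
  (forall i, measurable_fun setT (g i)) -> (forall i x, 0 <= g i x) ->
  (forall i, (\int[P]_w (g i (Y i w))%:E = (m i)%:E)%E) ->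
  (forall i, i \notin s -> exists2 B, measurable B & g i = \1_B) ->
  (\int[P]_w (\prod_i g i (Y i w))%:E = (\prod_i m i)%:E)%E.
Proof.
elim: s g m => [|i s IH] g m mg g0 gm gI.
  have /choice[B mB] : forall i, exists B, measurable B /\ g i = \1_B.
    by move=> i; have [|B mB gB] := gI i; [rewrite in_nil|exists B].
  have mE i : (m i)%:E = P (Y i @^-1` B i).
    by rewrite -gm (mB i).2 P_indic//; exact: measurable_funPTI (mB i).1.
  rewrite -prodEFin (eq_bigr _ (fun i _ => mE i)).
  have := Y_indep [set: I]%SET (fun i => (mB i).1).
  under [X in _ = X -> _]eq_bigl do rewrite finset.in_setT.
  move=> <-; rewrite P_indic; last first.
    apply: fin_bigcap_measurable; first exact: finite_finset.
    by move=> i _; exact: measurable_funPTI (mB i).1.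
  apply: eq_integral => w _; congr EFin.
  rewrite indicE; have [/set_mem wB|/negP wB] := boolP (w \in _).
    rewrite big1// => i _; rewrite (mB i).2 indicE mem_set//.
    by apply: wB; rewrite /= finset.in_setT.
  have [i wi] : exists i, ~ B i (Y i w).
    apply/existsNP => wB'; apply: wB; apply/mem_set => i _; exact: wB'.
  by rewrite (bigD1 i)//= (mB i).2 indicE memNset// mul0r.
have mh : measurable_fun setT (fun w => \prod_(j | j != i) g j (Y j w)).
  under eq_fun do rewrite big_mkcond/=.
  by apply: measurable_prod => j _; case: (j != i) => //; exact: measurableT_comp.
pose c := \prod_(j | j != i) m j.
have m0 j : 0 <= m j.
  by rewrite -lee_fin -gm integral_ge0// => w _; rewrite lee_fin.
have c0 : 0 <= c by exact: prodr_ge0.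
transitivity (\int[P]_w (g i (Y i w) * \prod_(j | j != i) g j (Y j w))%:E)%E.
  by apply: eq_integral => w _; rewrite (bigD1 i).
rewrite (@ge0_integral_density _ _ _ _ _ P
  (mscale (NngNum c0) (distribution P (Y i))))//.
- rewrite ge0_integral_mscale//=; last 2 first.
  + by apply/measurable_EFinP.
  + by move=> y _; rewrite lee_fin.
  rewrite ge0_integral_distribution//; last 2 first.
  + exact/measurable_EFinP.
  + by move=> y; rewrite lee_fin.
  by rewrite /= gm -EFinM (bigD1 i)//= mulrC.
- by move=> w; exact: prodr_ge0.
move=> B mB.
pose g' j := if j == i then \1_B else g j.
pose m' j := if j == i then fine (P (Y i @^-1` B)) else m j.
have mYB : measurable (Y i @^-1` B) by exact: measurable_funPTI.
have := IH g' m'.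
rewrite (bigD1 i)//= /m' eqxx (eq_bigr m); last by move=> j /negbTE ->.
rewrite /mscale/= EFinM fineK ?fin_num_measure// [RHS]muleC => <-.
- apply: eq_integral => w _; rewrite [in RHS](bigD1 i)//= /g' eqxx.
  by congr (_ * _)%:E; apply: eq_bigr => j /negbTE ->.
- by move=> j; rewrite /g'; case: ifP.
- by move=> j x; rewrite /g'; case: ifP.
- move=> j; rewrite /g'; case: ifP => [/eqP ->|//].
  by rewrite fineK ?fin_num_measure// P_indic.
- move=> j js; rewrite /g'; case: ifPn => ji; first by exists B.
  by apply: gI; rewrite inE negb_or ji.
Qed.

Lemma ge0_expectation_prod (g : I -> R -> R) (m : I -> R) :
  (forall i, measurable_fun setT (g i)) -> (forall i x, 0 <= g i x) ->
  (forall i, (\int[P]_w (g i (Y i w))%:E = (m i)%:E)%E) ->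
  (\int[P]_w (\prod_i g i (Y i w))%:E = (\prod_i m i)%:E)%E.
Proof.
move=> mg g0 gm; apply: (@ge0_expectation_prod_aux (enum I)) => // i.
by rewrite mem_enum.
Qed.

(** Splitting every factor into positive and negative parts writes the product as a signed sum, over
    all sign patterns, of nonnegative products. Each of those factors in expectation, and
    distributivity reassembles the result. *)
Lemma expectation_prod (g : I -> R -> R) :
  (forall i, measurable_fun setT (g i)) ->
  (forall i, P.-integrable setT (fun w => (g i (Y i w))%:E)) ->
  P.-integrable setT (fun w => (\prod_i g i (Y i w))%:E) /\
  \int[P]_w (\prod_i g i (Y i w)) = \prod_i \int[P]_w g i (Y i w).
Proof.
move=> mg ig.
have mY i (f : R -> R) : measurable_fun setT f ->
    measurable_fun setT (fun w => f (Y i w)).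
  by move=> mf; exact: measurableT_comp.
pose gs i (b : bool) : R -> R := if b then (g i)^\+ else (g i)^\-.
have mgs i b : measurable_fun setT (gs i b).
  by case: b; [exact: measurable_funrpos|exact: measurable_funrneg].
have gs0 i b x : 0 <= gs i b x.
  by case: b; [exact: funrpos_ge0|exact: funrneg_ge0].
have igs i b : P.-integrable setT (fun w => (gs i b (Y i w))%:E).
  have := ig i; case: b => ?.
    exact: (integrable_funrpos measurableT).
  exact: (integrable_funrneg measurableT).
pose ms i b := \int[P]_w gs i b (Y i w).
have msE i b : (\int[P]_w (gs i b (Y i w))%:E = (ms i b)%:E)%E.
  by rewrite fineK//; exact: integrable_fin_num.
have Eprod (f : {ffun I -> bool}) := ge0_expectation_prod
  (fun i => mgs i (f i)) (fun i => gs0 i (f i)) (fun i => msE i (f i)).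
have iprod (f : {ffun I -> bool}) :
    P.-integrable setT (fun w => (\prod_i gs i (f i) (Y i w))%:E).
  apply/integrableP; split.
    by apply/measurable_EFinP; apply: measurable_prod => i _; exact: mY.
  under eq_integral.
    by move=> w _; rewrite gee0_abs ?lee_fin ?prodr_ge0//; over.
  by rewrite Eprod ltry.
have gE i x : g i x = \sum_(b : bool) (if b then gs i b x else - gs i b x).
  by rewrite big_bool /= -[in LHS](funrposBneg (g i)).
pose sg (f : {ffun I -> bool}) : R := \prod_i (if f i then 1 else -1).
have sgE (f : {ffun I -> bool}) (a : I -> bool -> R) :
    \prod_i (if f i then a i (f i) else - a i (f i)) =
    sg f * \prod_i a i (f i).
  rewrite -big_split /=; apply: eq_bigr => i _.
  by case: (f i); rewrite ?mul1r ?mulN1r.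
have prodE w : \prod_i g i (Y i w) =
    \sum_(f : {ffun I -> bool}) sg f * \prod_i gs i (f i) (Y i w).
  under eq_bigr do rewrite gE.
  by rewrite bigA_distr_bigA; apply: eq_bigr => f _;
     rewrite -(sgE f (fun i b => gs i b (Y i w))).
have iZ (f : {ffun I -> bool}) :
    P.-integrable setT (fun w => (sg f * \prod_i gs i (f i) (Y i w))%:E).
  by under eq_fun do rewrite EFinM; exact: integrableZl.
have iP : P.-integrable setT (fun w => (\prod_i g i (Y i w))%:E).
  rewrite (_ : (fun _ => _) = fun w =>
    (\sum_(f : {ffun I -> bool}) (sg f * \prod_i gs i (f i) (Y i w))%:E)%E).
    by apply: integrable_sum.
  by apply/funext => w; rewrite prodE -sumEFin.
split=> //.
transitivity (\sum_(f : {ffun I -> bool}) sg f * \prod_i ms i (f i)).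
  apply: EFin_inj; rewrite /Rintegral fineK; last exact: integrable_fin_num.
  under eq_integral do rewrite prodE -sumEFin.
  rewrite integral_sum// -sumEFin; apply: eq_bigr => f _.
  under eq_integral do rewrite EFinM.
  by rewrite integralZl// Eprod.
transitivity (\prod_i \sum_(b : bool) if b then ms i b else - ms i b).
  by rewrite bigA_distr_bigA; apply: eq_bigr => f _; rewrite -sgE.
apply: eq_bigr => i _; rewrite big_bool /=.
rewrite -RintegralB//; [|exact: (igs i true)|exact: (igs i false)].
by apply: eq_Rintegral => w _; rewrite -[in RHS](funrposBneg (g i)).
Qed.

End independent_products.

(** * Moments of the standard normal law *)

Section normal_moments.
Context {R : realType}.
Local Notation mu := (@lebesgue_measure R).
Local Notation phi := (@normal_pdf R 0 1).

Lemma normal_pdf01E x : phi x = normal_peak 1 * expR (- (x ^+ 2 / 2)).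
Proof.
by rewrite normal_pdfE ?oner_eq0// /normal_fun subr0 expr1n mulNr.
Qed.

Lemma is_derive_normal_pdf (x : R) : is_derive x 1 phi (- (x * phi x)).
Proof.
have dq : is_derive x 1 (fun x : R => - (x ^+ 2 / 2)) (- x).
  have -> : (fun x : R => - (x ^+ 2 / 2)) = (- 2^-1) \*: (id ^+ 2).
    by apply/funext => y /=; rewrite /GRing.scale/= !fctE; ring.
  by apply: is_derive_eq; rewrite /GRing.scale/= expr1; field.
have phiE : phi = normal_peak 1 \*: (expR \o (fun x => - (x ^+ 2 / 2))).
  by apply/funext => y; rewrite normal_pdf01E.
rewrite [X in is_derive _ _ X _]phiE; apply: is_derive_eq.
by rewrite normal_pdf01E /GRing.scale/=; ring.
Qed.

(** This is the boundary term of the integration by parts below. The Taylor term of order [e.+1] of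
    the exponential at [x^2 / 2] bounds it by a constant times [1 / x], hence by a multiple of the
    harmonic sequence. *)
Lemma cvg_exp_normal_pdf (e : nat) :
  (n%:R ^+ e.+1 * phi n%:R : R) @[n --> \oo] --> (0 : R).
Proof.
pose C : R := e.+1`!%:R * 2 ^+ e.+1.
have phi0 x : 0 <= phi x by exact: normal_pdf_ge0.
rewrite -cvg_shiftS /=.
apply: (@squeeze_cvgr _ _ _ _ (cst 0) (fun n => normal_peak 1 * C * harmonic n)); last 2 first.
- exact: cvg_cst.
- rewrite -[X in _ --> X](mulr0 (normal_peak 1 * C)); apply: cvgM; [exact: cvg_cst|].
  exact: cvg_harmonic.
apply: nearW => n; rewrite mulr_ge0//= normal_pdf01E [leLHS]mulrCA -[leRHS]mulrA.
rewrite ler_wpM2l ?normal_peak_ge0// expRN.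
set x : R := n.+1%:R; have x1 : 1 <= x by rewrite ler1n.
have x0 : 0 < x by exact: lt_le_trans x1.
rewrite ler_pdivrMr ?expR_gt0//.
have y0 : 0 <= x ^+ 2 / 2 by rewrite divr_ge0// exprn_ge0// ltW.
have := expR_ge1Dxn e y0 => /(le_trans _) H.
have {}H : (x ^+ 2 / 2) ^+ e.+1 / e.+1`!%:R <= expR (x ^+ 2 / 2).
  by apply: H; rewrite lerDr.
have fact0 : 0 < e.+1`!%:R :> R by rewrite ltr0n fact_gt0.
have -> : x ^+ e.+1 = e.+1`!%:R * 2 ^+ e.+1 * x^-1 *
    ((x ^+ 2 / 2) ^+ e.+1 / e.+1`!%:R) * (x ^- e).
  rewrite expr_div_n -exprM mulnC exprM exprS -exprVn.
  have xe0 : x ^+ e != 0 by rewrite expf_neq0// gt_eqF.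
  rewrite exprVn expr2 !exprS; field.
  by rewrite xe0 gt_eqF//= expf_neq0//= nat1r pnatr_eq0.
rewrite -mulrA -[x^-1]/(harmonic n) -/C.
rewrite ler_wpM2l ?mulr_ge0 ?exprn_ge0 ?invr_ge0 ?(ltW fact0)//.
rewrite -[leRHS]mulr1 ler_pM// ?divr_ge0 ?exprn_ge0 ?invr_ge0 ?exprn_ge0 ?(ltW x0)//.
by rewrite invf_le1 ?exprn_gt0// exprn_ege1.
Qed.

Let measurable_norm_exp (e : nat) : measurable_fun setT (fun x : R => `|x| ^+ e).
Proof. exact: measurable_funX. Qed.

(** On the half line the integrand is nonnegative, so the truncated integrals converge to it
    monotonically. The value stays in the extended reals because the recursion is proved before
    finiteness, and then yields it. *)
Let half_moment (e : nat) : \bar R :=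
  (\int[mu]_(x in `[0%R, +oo[) (x ^+ e * phi x)%:E)%E.

Let continuous_exp_normal_pdf e : continuous (fun x : R => x ^+ e * phi x).
Proof.
move=> x; apply: cvgM; first exact: exprn_continuous.
exact: continuous_normal_pdf (oner_neq0 _) x.
Qed.

Let is_derive_exp (e : nat) (x : R) :
  is_derive x 1 (fun x => x ^+ e.+1) (e.+1%:R * x ^+ e).
Proof.
have -> : (fun x : R => x ^+ e.+1) = id ^+ e.+1.
  by apply/funext => y; rewrite !fctE.
by apply: is_derive_eq; rewrite /GRing.scale/= mulr1.
Qed.

Let derivable_LR (F f : R -> R) (a b : R) :
  (forall x : R, is_derive x 1 F (f x)) -> derivable_oo_LRcontinuous F a b.
Proof.
move=> dF.
have cF x : {for x, continuous F}.
  by apply/differentiable_continuous/derivable1_diffP; have [] := dF x.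
split.
- by move=> x _; have [] := dF x.
- by apply: cvg_at_right_filter; exact: cF.
- by apply: cvg_at_left_filter; exact: cF.
Qed.

Let truncated_moment (e n : nat) :
  (\int[mu]_(x in `[0%R, n.+1%:R]) (x ^+ e.+2 * phi x)%:E =
   (- (n.+1%:R ^+ e.+1 * phi n.+1%:R))%:E +
   e.+1%:R%:E * \int[mu]_(x in `[0%R, n.+1%:R]) (x ^+ e * phi x)%:E)%E.
Proof.
have dN (x : R) : is_derive x 1 (fun x => - phi x) (x * phi x).
  by rewrite -[X in is_derive _ _ _ X]opprK; exact/is_deriveN/is_derive_normal_pdf.
have cw (f : R -> R) A : continuous f -> {within A, continuous f}.
  exact: continuous_subspaceT.
transitivity (\int[mu]_(x in `[0%R, n.+1%:R]) (x ^+ e.+1 * (x * phi x))%:E)%E.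
  by apply: eq_integral => x _; rewrite mulrA -exprSr.
rewrite (@integration_by_parts _ _ (fun x => - phi x)
  (fun x => e.+1%:R * x ^+ e) (fun x => x * phi x)).
- rewrite (exprS 0) !mul0r subr0 mulrN; congr (_ + _)%E.
  under eq_integral do rewrite mulrN -mulrA -mulNr EFinM.
  rewrite integralZl//; last first.
    apply: continuous_compact_integrable; first exact: segment_compact.
    exact/cw/continuous_exp_normal_pdf.
  by rewrite EFinN mulNe oppeK.
- by rewrite ltr0n.
- apply: cw => x; apply: cvgM; [exact: cvg_cst|exact: exprn_continuous].
- exact: derivable_LR (is_derive_exp e).
- by move=> x _; rewrite derive1E; have [_ ->] := is_derive_exp e x.
- apply: cw => x; apply: cvgM; first exact: cvg_id.
  exact: continuous_normal_pdf (oner_neq0 _) x.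
- exact: derivable_LR dN.
- by move=> x _; rewrite derive1E; have [_ ->] := dN x.
Qed.

Let exp_normal_pdf_ge0 (e : nat) (x : R) : 0 <= x -> 0 <= x ^+ e * phi x.
Proof. by move=> x0; rewrite mulr_ge0 ?exprn_ge0 ?normal_pdf_ge0. Qed.

Let cvg_half_moment (e : nat) :
  ((\int[mu]_(x in `[0%R, n.+1%:R]) (x ^+ e * phi x)%:E) @[n --> \oo] -->
   half_moment e)%E.
Proof.
pose f (x : R) := `|x| ^+ e * phi x.
have f0 x : 0 <= f x by rewrite mulr_ge0 ?exprn_ge0 ?normal_pdf_ge0.
have mf : measurable_fun setT f.
  apply: measurable_funM; last exact: measurable_normal_pdf.
  exact: measurable_norm_exp.
have fE (x : R) : x \in (`[0%R, +oo[%classic : set R) ->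
    (f x)%:E = (x ^+ e * phi x)%:E.
  by rewrite inE/= in_itv/= andbT /f => x0; rewrite ger0_norm.
have -> : half_moment e = (\int[mu]_(x in `[0%R, +oo[) (f x)%:E)%E.
  by apply: eq_integral => x xi; rewrite fE.
have := @ge0_cvgn_integral R mu f f0 mf; rewrite -cvg_shiftS/= => H; apply: cvg_trans H.
apply: near_eq_cvg; apply: nearW => n.
apply: eq_integral => x; rewrite inE/= in_itv/= => /andP[x0 _].
by rewrite /f ger0_norm.
Qed.

Let half_moment_rec e : half_moment e.+2 = (e.+1%:R%:E * half_moment e)%E.
Proof.
have := @cvg_half_moment e.+2; under eq_fun do rewrite truncated_moment.
move=> /cvg_lim <-//; apply/cvg_lim => //.
rewrite -[X in _ --> X]add0e; apply: cvgeD => //.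
- apply: cvg_EFin; first exact: nearW.
  have := cvg_exp_normal_pdf e; rewrite -cvg_shiftS/= => /cvgN.
  by rewrite oppr0.
- by apply: cvgeZl => //; exact: cvg_half_moment.
Qed.

Let half_moment_ge0 e : (0 <= half_moment e)%E.
Proof.
apply: integral_ge0 => x /=; rewrite in_itv/= andbT => x0.
by rewrite lee_fin exp_normal_pdf_ge0.
Qed.

(** The recursion advances by two, so two starting values are needed: order 0 is bounded by the
    total mass, and order 1 follows from orders 0 and 2 through [x <= 1 + x^2]. *)
Let half_moment_lty e : (half_moment e < +oo)%E.
Proof.
have m0 : (half_moment 0 < +oo)%E.
  rewrite (@le_lt_trans _ _ 1%E) ?ltry// -(integral_normal_pdf 0 1).
  under [leLHS]eq_integral do rewrite mul1r.
  apply: ge0_subset_integral => //.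
  - by apply/measurable_EFinP; apply: measurable_normal_pdf.
  - by move=> x _; rewrite lee_fin normal_pdf_ge0.
have m2 : (half_moment 2 < +oo)%E by rewrite half_moment_rec mul1e.
have mf : forall j, measurable_fun (`[0%R, +oo[%classic : set R)
    (fun x => (x ^+ j * phi x)%:E).
  move=> j; apply/measurable_EFinP; apply: measurable_funTS.
  by apply: continuous_measurable_fun; exact: continuous_exp_normal_pdf.
have f0 : forall j (x : R), (`[0%R, +oo[%classic : set R) x ->
    (0 <= (x ^+ j * phi x)%:E)%E.
  move=> j x; rewrite /= in_itv/= andbT => x0.
  by rewrite lee_fin exp_normal_pdf_ge0.
have m1 : (half_moment 1 < +oo)%E.
  apply: (@le_lt_trans _ _ (half_moment 0 + half_moment 2)%E); last first.
    by rewrite lte_add_pinfty.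
  rewrite /half_moment -ge0_integralD;
    [|exact: measurable_itv|exact: f0|exact: mf|exact: f0|exact: mf].
  apply: ge0_le_integral;
    [exact: measurable_itv|exact: f0|exact: mf| |].
    by apply: emeasurable_funD; exact: mf.
  move=> x _; rewrite -EFinD lee_fin -mulrDl ler_wpM2r ?normal_pdf_ge0//.
  by rewrite expr0 expr1; nra.
have : (half_moment e < +oo)%E /\ (half_moment e.+1 < +oo)%E.
  elim: e => [|e [IH1 IH2]]; first by split.
  by split=> //; rewrite half_moment_rec lte_mul_pinfty.
by case.
Qed.

Context d (T : measurableType d) (P : probability T R) (Y : {RV P >-> R}).
Hypothesis Y_normal : distribution P Y = normal_prob 0 1 :> (set R -> \bar R).

Let ge0_expectation_normal (f : R -> R) : measurable_fun setT f ->
  (forall x, 0 <= f x) ->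
  (\int[P]_w (f (Y w))%:E = \int[mu]_x (f x * phi x)%:E)%E.
Proof.
move=> mf f0.
rewrite (@ge0_integral_density _ _ _ _ _ mu (distribution P Y) id phi)//.
- rewrite ge0_integral_distribution//; first exact/measurable_EFinP.
- exact: measurable_normal_pdf.
- by move=> x; exact: normal_pdf_ge0.
move=> B mB; apply: etrans (esym (congr1 (fun m => m B) Y_normal)).
rewrite /normal_prob [RHS]integral_mkcond.
apply: eq_integral => x _; rewrite patchE indicE.
by case: ifPn => xB; rewrite ?mul1r ?mul0r.
Qed.

Let expectation_norm_exp e :
  (\int[P]_w (`|Y w| ^+ e)%:E = 2%:E * half_moment e)%E.
Proof.
rewrite (ge0_expectation_normal (f := fun x => `|x| ^+ e)); last 2 first.
- exact: measurable_norm_exp.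
- by move=> x; rewrite exprn_ge0.
rewrite ge0_symfun_integralT.
- congr (_ * _)%E; rewrite -set_itvcy; apply: eq_integral => x.
  by rewrite inE/= in_itv/= andbT => x0; rewrite ger0_norm.
- by move=> x; rewrite mulr_ge0 ?exprn_ge0 ?normal_pdf_ge0.
- move=> x; apply: cvgM; last exact: continuous_normal_pdf (oner_neq0 _) x.
  apply: (@cvg_comp _ _ _ (fun x => `|x|) (fun x => x ^+ e)).
    by apply: cvg_norm; exact: cvg_id.
  exact: exprn_continuous.
- by move=> x /=; rewrite normrN !normal_pdf01E sqrrN.
Qed.

Lemma integrable_normal_exp e : P.-integrable setT (fun w => (Y w ^+ e)%:E).
Proof.
apply/integrableP; split.
  exact/measurable_EFinP/measurable_funX.
under eq_integral do rewrite abse_EFin normrX.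
by rewrite expectation_norm_exp lte_mul_pinfty.
Qed.

Let normal_sym (f : R -> R) : measurable_fun setT f -> (forall x, 0 <= f x) ->
  (\int[P]_w (f (- Y w))%:E = \int[P]_w (f (Y w))%:E)%E.
Proof.
move=> mf f0.
have mfN : measurable_fun setT (fun x : R => f (- x)) by exact: measurableT_comp.
rewrite (ge0_expectation_normal (f := fun x => f (- x)))//.
rewrite ge0_expectation_normal//.
pose g (x : R) := (f x * phi x)%:E.
transitivity (\int[mu]_x g (- (x : R))%R)%E.
  by apply: eq_integral => x _; rewrite /g !normal_pdf01E sqrrN.
have mg : measurable_fun [set: R] g.
  apply/measurable_EFinP; apply: measurable_funM => //.
  exact: measurable_normal_pdf.
rewrite -[RHS](@eq_measure_integral _ _ _ _ _
  (pushforward mu (-%R : _ -> measurableTypeR R))); last first.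
  by move=> A mA _; exact: lebesgue_measureN.
rewrite ge0_integral_pushforward// => x _.
by rewrite lee_fin mulr_ge0 ?normal_pdf_ge0.
Qed.

Let normal_moment_odd e : odd e -> \int[P]_w (Y w ^+ e) = 0.
Proof.
move=> oe; pose f (x : R) := x ^+ e.
have mf : measurable_fun setT f by exact: measurable_funX.
have fN x : f (- x) = - f x by rewrite /f exprNn -signr_odd oe expr1 mulN1r.
have iY := integrable_normal_exp e.
have ip : P.-integrable setT (fun w => (f^\+ (Y w))%:E).
  exact: (integrable_funrpos measurableT iY).
have iN : P.-integrable setT (fun w => (f^\- (Y w))%:E).
  exact: (integrable_funrneg measurableT iY).
transitivity (\int[P]_w (f^\+ (Y w) - f^\- (Y w))).
  apply: eq_Rintegral => w _.
  by rewrite -[LHS]/(f (Y w)) -[in LHS](funrposBneg f).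
rewrite RintegralB//; apply/eqP; rewrite subr_eq0; apply/eqP.
rewrite /Rintegral -normal_sym//; last exact: measurable_funrpos.
by congr fine; apply: eq_integral => w _; rewrite /funrpos /funrneg fN.
Qed.

Let normal_moment_even e : ~~ odd e ->
  \int[P]_w (Y w ^+ e) = 2 * fine (half_moment e).
Proof.
move=> oe; rewrite /Rintegral.
have -> : (\int[P]_w (Y w ^+ e)%:E = 2%:E * half_moment e)%E.
  rewrite -expectation_norm_exp; apply: eq_integral => w _.
  by rewrite -normrX ger0_norm// exprn_even_ge0.
rewrite fineM// ge0_fin_numE//.
Qed.

(** Stein's identity on monomials. For [e = 0] the truncated predecessor is harmless: the factor [e]
    vanishes, and the identity says that the mean is zero. *)
Lemma normal_momentS e :
  \int[P]_w (Y w ^+ e.+1) = e%:R * \int[P]_w (Y w ^+ e.-1).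
Proof.
case: e => [|e]; first by rewrite mul0r normal_moment_odd.
have [oe|oe] := boolP (odd e).
  by rewrite !normal_moment_odd ?mulr0//= negbK.
rewrite !normal_moment_even//= ?negbK// half_moment_rec fineM//.
  by rewrite mulrCA.
by rewrite ge0_fin_numE.
Qed.

End normal_moments.

(** * Polynomials in independent Gaussians *)

Section gaussian_polynomials.
Context d (T : measurableType d) (R : realType) (P : probability T R).
Context (N : nat) (Y : 'I_N -> {RV P >-> R}).
Hypothesis Y_indep : mutually_independent Y.
Hypothesis Y_normal : forall i,
  distribution P (Y i) = normal_prob 0 1 :> (set R -> \bar R).
Local Notation poly := (mpoly.mpoly N R).
Implicit Types q r : poly.

Definition rv_eval q (w : T) : R := mpoly.meval (fun i => Y i w) q.

Lemma rv_evalM q r w : rv_eval (q * r) w = rv_eval q w * rv_eval r w.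
Proof. exact: rmorphM. Qed.

Definition poly_expectation q : R := \int[P]_w rv_eval q w.
Local Notation EE := poly_expectation.

Let expectation_monomial (m : mpoly.multinom N) :
  P.-integrable setT (fun w => (rv_eval (mpoly.mpolyX R m) w)%:E) /\
  EE (mpoly.mpolyX R m) = \prod_i \int[P]_w (Y i w ^+ m i).
Proof.
have [] := expectation_prod Y_indep (g := fun i x => x ^+ m i).
- by move=> i; exact: measurable_funX.
- by move=> i; exact: integrable_normal_exp (Y_normal i) _.
move=> iP EP.
have mE : (fun w => rv_eval (mpoly.mpolyX R m) w) =
    fun w => \prod_i Y i w ^+ m i.
  by apply/funext => w; rewrite /rv_eval mpoly.mevalX.
split; first by under eq_fun do rewrite /rv_eval mpoly.mevalX.
by rewrite -EP; apply: eq_Rintegral => w _; rewrite /rv_eval mpoly.mevalX.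
Qed.

Lemma integrable_rv_eval q : P.-integrable setT (fun w => (rv_eval q w)%:E).
Proof.
elim/mpoly.mpolyind: q => [|c m q _ _ IH].
  under eq_fun do rewrite /rv_eval mpoly.meval0.
  exact: integrable0.
under eq_fun do rewrite /rv_eval mpoly.mevalD mpoly.mevalZ EFinD EFinM.
apply: integrableD => //; apply: integrableZl => //.
by case: (expectation_monomial m).
Qed.

Lemma poly_expectationD q r : EE (q + r) = EE q + EE r.
Proof.
rewrite /poly_expectation; under eq_Rintegral do rewrite /rv_eval mpoly.mevalD.
by rewrite RintegralD//; exact: integrable_rv_eval.
Qed.

Lemma poly_expectationZ c q : EE (c *: q) = c * EE q.
Proof.
rewrite /poly_expectation; under eq_Rintegral do rewrite /rv_eval mpoly.mevalZ.
by rewrite RintegralZl//; exact: integrable_rv_eval.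
Qed.

Lemma poly_expectation0 : EE 0 = 0.
Proof. by rewrite -(scale0r 0) poly_expectationZ mul0r. Qed.

Lemma poly_expectation_sum (I : Type) (s : seq I) (A : pred I) (F : I -> poly) :
  EE (\sum_(i <- s | A i) F i) = \sum_(i <- s | A i) EE (F i).
Proof.
exact: (big_morph _ poly_expectationD poly_expectation0).
Qed.

Lemma poly_expectationMn q k : EE (q *+ k) = EE q *+ k.
Proof. by rewrite -scaler_nat poly_expectationZ mulr_natl. Qed.

Lemma poly_expectation1 : EE 1 = 1.
Proof.
rewrite /poly_expectation /rv_eval; under eq_Rintegral do rewrite mpoly.meval1.
by rewrite Rintegral_cst// mul1r; exact: (congr1 fine (probability_setT P)).
Qed.

Lemma le_poly_expectation q r : (forall w, rv_eval q w <= rv_eval r w) ->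
  EE q <= EE r.
Proof. by move=> qr; apply: le_Rintegral => //; exact: integrable_rv_eval. Qed.

(** Both sides are linear in [q], so monomials suffice; there the expectation factors over the
    coordinates, and only the factor at [i] changes, by Stein's identity. *)
Lemma gaussian_integration_by_parts i q :
  EE (mpoly.mpolyX R (mpoly.mnm1 i) * q) = EE (mpoly.mderiv i q).
Proof.
elim/mpoly.mpolyind: q => [|c m q _ _ IH].
  by rewrite mulr0 mpoly.mderiv0.
rewrite mulrDr mpoly.mderivD !poly_expectationD IH; congr (_ + _).
rewrite -scalerAr mpoly.mderivZ !poly_expectationZ; congr (_ * _).
rewrite -mpoly.mpolyXD mpoly.mderivX poly_expectationZ.
rewrite !(expectation_monomial _).2 (bigD1 i)//= [in RHS](bigD1 i)//= mulrA.
rewrite mpoly.mnmDE mpoly.mnm1E eqxx add1n (normal_momentS (Y_normal i)).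
rewrite mpoly.mnmBE mpoly.mnm1E eqxx subn1; congr (_ * _).
apply: eq_bigr => j ji; rewrite mpoly.mnmDE mpoly.mnmBE mpoly.mnm1E.
by rewrite eq_sym (negbTE ji) add0n subn0.
Qed.

Lemma measurable_rv_eval q : measurable_fun setT (rv_eval q).
Proof.
by apply/measurable_EFinP; have /integrableP[] := integrable_rv_eval q.
Qed.

Lemma measurable_rv_le q a : measurable [set w | rv_eval q w <= a].
Proof.
rewrite -[X in measurable X]setTI; apply: measurable_fun_le => //.
exact: measurable_rv_eval.
Qed.

Lemma poly_markov q a : (forall w, 0 <= rv_eval q w) -> 0 < a ->
  ((1 - EE q / a)%:E <= P [set w | (rv_eval q w <= a)%R])%E.
Proof.
move=> q0 a0.
have mA : measurable [set w | rv_eval q w <= a].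
  exact: measurable_rv_le.
have : ((a%:E * P (~` [set w | (rv_eval q w <= a)%R])) <= (EE q)%:E)%E.
  have -> : (EE q)%:E = (\int[P]_w (rv_eval q w)%:E)%E.
    by rewrite fineK//; apply: integrable_fin_num => //; exact: integrable_rv_eval.
  rewrite -integral_cst; last exact: measurableC.
  apply: (@le_trans _ _ (\int[P]_(w in ~` [set w | (rv_eval q w <= a)%R])
    (rv_eval q w)%:E)%E).
    apply: ge0_le_integral => //.
    - exact: measurableC.
    - by move=> w _; rewrite lee_fin ltW.
    - by apply/measurable_EFinP/measurable_funTS; exact: measurable_rv_eval.
    - by move=> w /= /negP; rewrite -ltNge => /ltW; rewrite lee_fin.
  apply: ge0_subset_integral => //.
  - exact: measurableC.
  - by apply/measurable_EFinP; exact: measurable_rv_eval.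
  - by move=> w _; rewrite lee_fin.
rewrite probability_setC// -(fineK (fin_num_measure P _ mA)) -EFinB -EFinM !lee_fin.
by rewrite lerBlDr -lerBlDl ler_pdivlMr// mulrC.
Qed.

End gaussian_polynomials.

(** * Moments of Wishart traces *)

Section gram_powers.
Context {A : comNzRingType} {p n : nat}.
Implicit Types X : 'M[A]_(p, n).

Definition wishart X : 'M[A]_p := X *m X^T.
Definition wishart_dual X : 'M[A]_n := X^T *m X.
(** Up to transposition and the factor [2 * k.+1], this is the gradient of the trace of
    [wishart X ^+ k.+1] with respect to the entries of [X]. *)
Definition wishart_cofactor X (k : nat) : 'M[A]_(n, p) := X^T *m wishart X ^+ k.

Lemma tr_wishart X k : (wishart X ^+ k)^T = wishart X ^+ k.
Proof.
elim: k => [|k IH]; first by rewrite expr0 tr_scalar_mx.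
rewrite exprSr -mulmxE trmx_mul IH {1}/wishart trmx_mul trmxK.
by rewrite -/(wishart X) mulmxE -exprS -exprSr.
Qed.

Lemma wishart_dualX X k :
  X^T *m wishart X ^+ k *m X = wishart_dual X ^+ k.+1.
Proof.
elim: k => [|k IH]; first by rewrite expr0 mulmx1 expr1.
by rewrite exprSr -mulmxE [RHS]exprSr -mulmxE -IH !mulmxA.
Qed.

Lemma trace_wishart_dual X k :
  \tr (wishart_dual X ^+ k.+1) = \tr (wishart X ^+ k.+1).
Proof.
by rewrite -wishart_dualX -mulmxA mxtrace_mulC -mulmxA mulmxE -exprSr.
Qed.

Lemma trace_cofactor X k : \tr (X *m wishart_cofactor X k) = \tr (wishart X ^+ k.+1).
Proof. by rewrite /wishart_cofactor mulmxA mulmxE -exprS. Qed.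

Lemma trace_cofactor_mul X k l :
  \sum_a \sum_i wishart_cofactor X k i a * wishart_cofactor X l i a =
  \tr (wishart X ^+ (k + l).+1).
Proof.
rewrite exchange_big /=.
transitivity (\tr (wishart_cofactor X k *m (wishart_cofactor X l)^T)).
  by apply: eq_bigr => i _; rewrite [RHS]mxE; apply: eq_bigr => a _; rewrite [_^T _ _]mxE.
rewrite {2}/wishart_cofactor trmx_mul trmxK tr_wishart mulmxA mxtrace_mulC.
by rewrite !mulmxA mulmxE -exprS -exprD addSn.
Qed.

(** The two extreme terms of the convolution contain the trace of a zeroth power, [n] on the dual
    side and [p] on the other, which produces the coefficient [n + p]. In the remaining terms both
    powers are positive, so dual traces may be replaced by ordinary ones. *)
Lemma trace_convolution X m q :
  \sum_(j < m.+2) \tr (wishart_dual X ^+ j) * \tr (wishart X ^+ (m.+1 - j)) * q =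
  (\tr (wishart X ^+ m.+1) * q) *+ (n + p) +
  \sum_(i < m) \tr (wishart X ^+ i.+1) * (\tr (wishart X ^+ (m.-1 - i).+1) * q).
Proof.
rewrite big_ord_recl big_ord_recr /= subn0 subnn !expr0 !mxtrace1.
rewrite trace_wishart_dual addrCA [in RHS]addrC; congr (_ + _).
  apply: eq_bigr => i _; rewrite /bump leq0n add1n trace_wishart_dual mulrA.
  rewrite (_ : (m.+1 - i.+1 = (m.-1 - i).+1)%N)//.
  by have := ltn_ord i; clear; lia.
by rewrite -mulrDl (mulrC _ p%:R) -mulrDl -natrD -mulrA mulr_natl.
Qed.

End gram_powers.

(** * Leibniz rule for words in a matrix and its transpose *)

Section derivation.
Context {A : comNzRingType} (D : {additive A -> A}).
Hypothesis DM : forall x y, D (x * y) = D x * y + x * D y.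
Local Notation "M ^D" := (map_mx D M) (at level 2, format "M ^D").

Lemma derivation_mulmx m n p (B : 'M[A]_(m, n)) (C : 'M[A]_(n, p)) :
  (B *m C)^D = B^D *m C + B *m C^D.
Proof.
apply/matrixP => i j; rewrite !mxE raddf_sum -big_split /=.
by apply: eq_bigr => k _; rewrite !mxE DM.
Qed.

Let D1 : D 1 = 0.
Proof. by apply: (addIr (D 1)); rewrite add0r -{3}[1]mulr1 DM mulr1 mul1r. Qed.

Lemma derivation_exprmx p (B : 'M[A]_p) k :
  (B ^+ k)^D = \sum_(j < k) B ^+ j *m B^D *m B ^+ (k.-1 - j).
Proof.
elim: k => [|k IH].
  by rewrite big_ord0; apply/matrixP => i j; rewrite !mxE; case: (i == j) => /=;
     rewrite ?D1 ?raddf0.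
rewrite exprSr -mulmxE derivation_mulmx IH mulmx_suml big_ord_recr /=.
rewrite subnn expr0 mulmx1; congr (_ + _); apply: eq_bigr => j _.
rewrite -mulmxA mulmxE -exprSr; congr (_ *m _ ^+ _).
by have := ltn_ord j; lia.
Qed.

Context {p n : nat} (X : 'M[A]_(p, n)).

Lemma derivation_wishart : (wishart X)^D = X^D *m X^T + X *m (X^D)^T.
Proof. by rewrite derivation_mulmx map_trmx. Qed.

(** The word alternates [k.+1] transposed factors with [k] plain ones. A derivative falling on a
    transposed factor gives a term of the first sum, on a plain factor a term of the second. *)
Lemma derivation_cofactor k : (wishart_cofactor X k)^D =
  \sum_(j < k.+1) wishart_dual X ^+ j *m (X^D)^T *m wishart X ^+ (k - j) +
  \sum_(j < k) wishart_cofactor X j *m X^D *m wishart_cofactor X (k.-1 - j).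
Proof.
rewrite derivation_mulmx derivation_exprmx derivation_wishart map_trmx.
rewrite big_ord_recl expr0 mul1mx subn0 -addrA; congr (_ + _).
rewrite mulmx_sumr -big_split /=; apply: eq_bigr => j _.
rewrite mulmxDr mulmxDl mulmxDr [LHS]addrC; congr (_ + _).
  rewrite /bump leq0n add1n -wishart_dualX -!mulmxA; congr (_ *m (_ *m (_ *m (_ *m _ ^+ _)))).
  by have := ltn_ord j; lia.
by rewrite /wishart_cofactor !mulmxA.
Qed.

(** By cyclicity and transposition invariance of the trace, all [2 * k.+1] positions of the
    derivative contribute equally. *)
Lemma derivation_trace_wishart k :
  D (\tr (wishart X ^+ k.+1)) = \tr (X^D *m wishart_cofactor X k) *+ (2 * k.+1).
Proof.
have -> : D (\tr (wishart X ^+ k.+1)) = \tr ((wishart X ^+ k.+1)^D).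
  by rewrite raddf_sum; apply: eq_bigr => i _; rewrite mxE.
rewrite derivation_exprmx derivation_wishart raddf_sum /=.
rewrite (eq_bigr (fun=> \tr (X^D *m wishart_cofactor X k) *+ 2)); last first.
  move=> j _; rewrite -mulmxA mxtrace_mulC -mulmxA mulmxE -exprD.
  rewrite (_ : (k - j + j = k)%N); last by have := ltn_ord j; lia.
  rewrite mulrDl mxtraceD -!mulmxE mulr2n; congr (_ + _).
    by rewrite mulmxA.
  rewrite -mxtrace_tr !trmx_mul trmxK tr_wishart mxtrace_mulC -mulmxA.
  by rewrite /wishart_cofactor.
by rewrite sumr_const card_ord -mulrnA.
Qed.

End derivation.

(** * Integration by parts for traces of a matrix of indeterminates *)

Section generic_matrix.
Context {R : realType} {p n : nat}.
Local Notation N := #|{: 'I_p * 'I_n}|.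
Local Notation poly := (mpoly.mpoly N R).

Definition generic_mx : 'M[poly]_(p, n) :=
  \matrix_(a, i) mpoly.mpolyX R (mpoly.mnm1 (enum_rank (a, i))).
Local Notation X := generic_mx.
Local Notation der a i := (mpoly.mderiv (enum_rank (a, i))).

(* Index shift: [trace_power m] is the trace of the power [m.+1], so that the
   constant trace of the power 0 never occurs. *)
Definition trace_power (m : nat) : poly := \tr (wishart X ^+ m.+1).
Local Notation sg := trace_power.

Lemma derivation_generic_mx a i : map_mx (der a i) X = delta_mx a i.
Proof.
apply/matrixP => b j; rewrite !mxE mpoly.mderivX mpoly.mnm1E.
rewrite (inj_eq enum_rank_inj) xpair_eqE.
case: (b =P a) => [->|_]; last by rewrite scale0r.
case: (j =P i) => [->|_]; last by rewrite scale0r.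
rewrite scale1r -mpoly.mpolyX0; congr (mpoly.mpolyX _ _).
by apply/mpoly.mnmP => k; rewrite mpoly.mnmBE subnn mpoly.mnm0E.
Qed.

Let mul_delta_mul (A : comNzRingType) q r s t (B : 'M[A]_(q, r))
    (C : 'M[A]_(s, t)) i j k l :
  (B *m delta_mx i j *m C) k l = B k i * C j l.
Proof.
rewrite mxE (bigD1 j)//= big1 ?addr0 => [|u uj]; last first.
  rewrite mxE big1 ?mul0r// => v _.
  by rewrite mxE (negbTE uj) andbF mulr0.
rewrite mxE (bigD1 i)//= big1 ?addr0 => [|u ui]; last first.
  by rewrite mxE (negbTE ui) mulr0.
by rewrite mxE !eqxx mulr1.
Qed.

(** Differentiating the matrix in its entry [(a, i)] gives a matrix unit, which cuts the word in
    two. At a transposed factor the two pieces carry separate indices and close up into a product of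
    traces, the planar part; at a plain factor they share both indices and glue back into one trace,
    the non-planar part. *)
Lemma divergence_cofactor m :
  \sum_a \sum_i der a i (wishart_cofactor X m i a) =
  \sum_(j < m.+1) \tr (wishart_dual X ^+ j) * \tr (wishart X ^+ (m - j)) +
  \tr (wishart X ^+ m) *+ m.
Proof.
have dW a i : der a i (wishart_cofactor X m i a) =
    \sum_(j < m.+1) (wishart_dual X ^+ j) i i * (wishart X ^+ (m - j)) a a +
    \sum_(j < m) wishart_cofactor X j i a * wishart_cofactor X (m.-1 - j) i a.
  have := derivation_cofactor (@mpoly.mderivM _ _ (enum_rank (a, i))) X m.
  move=> /matrixP/(_ i a); rewrite mxE => ->.
  rewrite derivation_generic_mx trmx_delta mxE !summxE; congr (_ + _).
    by apply: eq_bigr => j _; rewrite mul_delta_mul.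
  by apply: eq_bigr => j _; rewrite mul_delta_mul.
under eq_bigr => a _ do under eq_bigr => i _ do rewrite dW.
under eq_bigr => a _ do rewrite big_split /=.
rewrite big_split /=; congr (_ + _).
  under eq_bigr => a _ do rewrite exchange_big /=.
  rewrite exchange_big /=; apply: eq_bigr => j _.
  rewrite mulr_sumr; apply: eq_bigr => a _.
  by rewrite mulr_suml.
under eq_bigr => a _ do rewrite exchange_big /=.
rewrite exchange_big /= (eq_bigr (fun=> \tr (wishart X ^+ m))); last first.
  move=> j _; rewrite trace_cofactor_mul; congr (\tr (_ ^+ _)).
  by have := ltn_ord j; lia.
by rewrite sumr_const card_ord.
Qed.

Lemma derivation_trace_power a i m :
  der a i (sg m) = wishart_cofactor X m i a *+ (2 * m.+1).
Proof.
rewrite /trace_power (derivation_trace_wishart (@mpoly.mderivM _ _ (enum_rank (a, i)))).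
rewrite derivation_generic_mx; congr (_ *+ _).
rewrite /mxtrace (bigD1 a)//= big1 ?addr0 => [|b ba]; last first.
  rewrite mxE big1// => j _; rewrite mxE (negbTE ba) mul0r//.
rewrite mxE (bigD1 i)//= big1 ?addr0 => [|j ji]; last first.
  by rewrite mxE (negbTE ji) andbF mul0r.
by rewrite mxE !eqxx mul1r.
Qed.

Lemma trace_powerE m :
  sg m = \sum_a \sum_i X a i * wishart_cofactor X m i a.
Proof.
by rewrite /trace_power -trace_cofactor; apply: eq_bigr => a _; rewrite [LHS]mxE.
Qed.

(* Carre-du-champ term of the integration by parts of [trace_power m] against [q]. *)
Definition trace_power_gradient m (q : poly) : poly :=
  \sum_a \sum_i wishart_cofactor X m i a * der a i q.
Local Notation grad := trace_power_gradient.

Lemma trace_power_gradient1 m : grad m 1 = 0.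
Proof.
rewrite /trace_power_gradient big1// => a _; rewrite big1// => i _.
by rewrite -mpoly.mpolyC1 mpoly.mderivC mulr0.
Qed.

Lemma trace_power_gradientM m q r : grad m (q * r) = grad m q * r + q * grad m r.
Proof.
rewrite /trace_power_gradient mulr_suml mulr_sumr -big_split /=.
apply: eq_bigr => a _; rewrite mulr_suml mulr_sumr -big_split /=.
by apply: eq_bigr => i _; rewrite mpoly.mderivM; ring.
Qed.

Lemma trace_power_gradient_trace m l :
  grad m (sg l) = sg (m + l) *+ (2 * l.+1).
Proof.
rewrite /sg -trace_cofactor_mul -sumrMnl; apply: eq_bigr => a _.
rewrite -sumrMnl; apply: eq_bigr => i _.
by rewrite derivation_trace_power mulrnAr.
Qed.

Context d (T : measurableType d) (P : probability T R).
Context (Y : 'I_N -> {RV P >-> R}).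
Hypothesis Y_indep : mutually_independent Y.
Hypothesis Y_normal : forall i,
  distribution P (Y i) = normal_prob 0 1 :> (set R -> \bar R).
Local Notation EE := (poly_expectation Y).

(** The Schwinger-Dyson equation of the Wishart ensemble: in the expansion of the trace as a sum of
    [X a i] times a cofactor entry, each [X a i] is integrated by parts against the cofactor and
    [q]. *)
Lemma trace_power_expectation m q :
  EE (sg m * q) =
  EE (\sum_(j < m.+1) \tr (wishart_dual X ^+ j) * \tr (wishart X ^+ (m - j)) * q) +
  EE (\tr (wishart X ^+ m) * q) *+ m + EE (grad m q).
Proof.
rewrite trace_powerE mulr_suml poly_expectation_sum//.
transitivity (\sum_a \sum_i EE (der a i (wishart_cofactor X m i a) * q +
    wishart_cofactor X m i a * der a i q)).
  apply: eq_bigr => a _; rewrite mulr_suml poly_expectation_sum//.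
  apply: eq_bigr => i _; rewrite -mulrA mxE.
  by rewrite gaussian_integration_by_parts// mpoly.mderivM.
under eq_bigr => a _ do rewrite -poly_expectation_sum// big_split/= -mulr_suml.
rewrite -poly_expectation_sum// big_split/= -mulr_suml divergence_cofactor.
rewrite mulrDl !poly_expectationD// mulr_suml mulrnAl poly_expectationMn//.
Qed.

Lemma trace_power_expectationS m q :
  EE (sg m.+1 * q) = EE (sg m * q) *+ (n + p) +
  \sum_(i < m) EE (sg i * (sg (m.-1 - i) * q)) +
  EE (sg m * q) *+ m.+1 + EE (grad m.+1 q).
Proof.
rewrite trace_power_expectation; congr (_ + _ + _).
rewrite -poly_expectationMn// -poly_expectation_sum// -poly_expectationD//.
exact: (congr1 EE (trace_convolution X m q)).
Qed.

End generic_matrix.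

(** * Submultiplicativity of traces of powers *)

Section gram_traces.
Context {R : realType}.

Lemma cauchy_schwarz_sum (I : Type) (s : seq I) (f g : I -> R) :
  (\sum_(i <- s) f i * g i) ^+ 2 <=
  (\sum_(i <- s) f i ^+ 2) * (\sum_(i <- s) g i ^+ 2).
Proof.
set a := \sum_(i <- s) f i ^+ 2; set b := \sum_(i <- s) g i ^+ 2.
set c := \sum_(i <- s) f i * g i.
have quad (x y : R) : 0 <= x ^+ 2 * a + y ^+ 2 * b - 2 * x * y * c.
  have -> : x ^+ 2 * a + y ^+ 2 * b - 2 * x * y * c =
      \sum_(i <- s) (x * f i - y * g i) ^+ 2.
    rewrite /a /b /c !mulr_sumr -big_split /= -sumrB.
    by apply: eq_bigr => i _; ring.
  by apply: sumr_ge0 => i _; exact: sqr_ge0.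
have b0 : 0 <= b by apply: sumr_ge0 => i _; exact: sqr_ge0.
have [b_eq0|b_neq0] := eqVneq b 0; last first.
  have {}b0 : 0 < b by rewrite lt_neqAle eq_sym b_neq0.
  rewrite -subr_ge0 -(pmulr_rge0 _ b0); have := quad b c.
  by congr (_ <= _); ring.
rewrite b_eq0 mulr0; have [->|c_neq0] := eqVneq c 0; first by rewrite expr0n.
(* With [b = 0] the form is affine in its second argument; this value brings it down to [-1], which
   [quad] forbids. *)
have := quad 1 ((a + 1) / (2 * c)); rewrite b_eq0.
have -> : 1 ^+ 2 * a + ((a + 1) / (2 * c)) ^+ 2 * 0 -
    2 * 1 * ((a + 1) / (2 * c)) * c = - 1 by field.
by rewrite ler0N1.
Qed.

Lemma trace_mul_tr m n (B : 'M[R]_(m, n)) :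
  \tr (B *m B^T) = \sum_i \sum_j B i j ^+ 2.
Proof.
apply: eq_bigr => i _; rewrite mxE; apply: eq_bigr => j _.
by rewrite [_^T _ _]mxE expr2.
Qed.

Lemma trace_mul_tr_ge0 m n (B : 'M[R]_(m, n)) : 0 <= \tr (B *m B^T).
Proof.
by rewrite trace_mul_tr; do 2 (apply: sumr_ge0 => ? _); exact: sqr_ge0.
Qed.

(** The left side is the squared Frobenius norm of [B^T *m C], each entry of which is bounded by
    Cauchy-Schwarz on a pair of columns. *)
Lemma trace_gramM m q r (B : 'M[R]_(m, q)) (C : 'M[R]_(m, r)) :
  \tr ((B *m B^T) *m (C *m C^T)) <= \tr (B *m B^T) * \tr (C *m C^T).
Proof.
have -> : \tr ((B *m B^T) *m (C *m C^T)) = \tr ((B^T *m C) *m (B^T *m C)^T).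
  by rewrite trmx_mul trmxK -!mulmxA mxtrace_mulC !mulmxA.
rewrite !trace_mul_tr [X in _ <= X * _]exchange_big [X in _ <= _ * X]exchange_big.
rewrite /= mulr_suml; apply: ler_sum => i _.
rewrite mulr_sumr; apply: ler_sum => j _; rewrite mxE.
under [X in X ^+ 2]eq_bigr do rewrite mxE.
exact: cauchy_schwarz_sum.
Qed.

Context {p n : nat} (X : 'M[R]_(p, n)).

(** An even power is the square of a symmetric matrix; in an odd one the middle factor [X *m X^T] is
    split between the two halves. This gives positivity and submultiplicativity of the traces
    without eigenvalues. *)
Lemma wishartX_gram k :
  exists q (B : 'M[R]_(p, q)), wishart X ^+ k = B *m B^T.
Proof.
have [t [->|->]] : exists t, k = t.*2 \/ k = t.*2.+1.
- exists k./2; have := odd_double_half k; case: (odd k) => <-; [right|left];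
  by rewrite ?add1n ?add0n /= ?doubleK ?uphalf_double.
- exists p, (wishart X ^+ t).
  by rewrite tr_wishart mulmxE -exprD addnn.
exists n, (wishart X ^+ t *m X); rewrite trmx_mul tr_wishart -mulmxA.
by rewrite (mulmxA X) -/(wishart X) !mulmxE -exprS -exprD addnS addnn.
Qed.

Lemma trace_wishartX_ge0 k : 0 <= \tr (wishart X ^+ k).
Proof. by have [q [B ->]] := wishartX_gram k; exact: trace_mul_tr_ge0. Qed.

Lemma trace_wishartXD k l :
  \tr (wishart X ^+ (k + l)) <= \tr (wishart X ^+ k) * \tr (wishart X ^+ l).
Proof.
rewrite exprD -mulmxE.
have [q [B ->]] := wishartX_gram k; have [r [C ->]] := wishartX_gram l.
exact: trace_gramM.
Qed.

End gram_traces.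

(** * Moment inequalities for products of traces *)

Section trace_moments.
Context {R : realType} {p n : nat}.
Local Notation N := #|{: 'I_p * 'I_n}|.
Local Notation poly := (mpoly.mpoly N R).
Context d (T : measurableType d) (P : probability T R).
Context (Y : 'I_N -> {RV P >-> R}).
Hypothesis Y_indep : mutually_independent Y.
Hypothesis Y_normal : forall i,
  distribution P (Y i) = normal_prob 0 1 :> (set R -> \bar R).
Local Notation EE := (poly_expectation Y).
Local Notation sg := (@trace_power R p n).

Definition random_mx (w : T) : 'M[R]_(p, n) :=
  \matrix_(a, i) Y (enum_rank (a, i)) w.

Lemma map_generic_mx w :
  map_mx (mpoly.meval (fun i => Y i w)) (@generic_mx R p n) = random_mx w.
Proof. by apply/matrixP => a i; rewrite !mxE mpoly.mevalXU. Qed.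

Lemma rv_eval_trace_power m w :
  rv_eval Y (sg m) w = \tr (wishart (random_mx w) ^+ m.+1).
Proof.
rewrite /rv_eval /trace_power -trace_map_mx; congr (\tr _).
have MX k : map_mx (mpoly.meval (fun i => Y i w)) (wishart generic_mx ^+ k) =
    wishart (random_mx w) ^+ k.
  elim: k => [|k IH]; first by rewrite !expr0 map_mx1.
  rewrite !exprS -!mulmxE map_mxM IH; congr (_ *m _).
  by rewrite map_mxM -map_trmx map_generic_mx.
exact: MX.
Qed.

Definition trace_product (ms : seq nat) : poly := \prod_(m <- ms) sg m.
Definition trace_degree (ms : seq nat) : nat := \sum_(m <- ms) m.+1.

Lemma rv_eval_trace_product ms w :
  rv_eval Y (trace_product ms) w = \prod_(m <- ms) rv_eval Y (sg m) w.
Proof. exact: rmorph_prod. Qed.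

Lemma rv_eval_trace_product_ge0 ms w : 0 <= rv_eval Y (trace_product ms) w.
Proof.
rewrite rv_eval_trace_product; apply: prodr_ge0 => m _.
by rewrite rv_eval_trace_power trace_wishartX_ge0.
Qed.

Lemma trace_product_expectation_ge0 ms : 0 <= EE (trace_product ms).
Proof.
rewrite -(poly_expectation0 Y_indep Y_normal).
apply: le_poly_expectation => // w; rewrite {1}/rv_eval mpoly.meval0.
exact: rv_eval_trace_product_ge0.
Qed.

(** For index 0 the cofactor is [X^T], so the gradient is Euler's operator, and the product is
    homogeneous of degree [2 * trace_degree ms]. Nothing is lost in this case. *)
Lemma trace_power_gradient0_product ms :
  trace_power_gradient 0 (trace_product ms) =
  trace_product ms *+ (2 * trace_degree ms).
Proof.
elim: ms => [|m ms IH]; rewrite /trace_product /trace_degree ?(big_nil, big_cons).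
  by rewrite trace_power_gradient1 muln0 mulr0n.
rewrite trace_power_gradientM trace_power_gradient_trace add0n IH.
by rewrite mulrnAl mulrnAr -mulrnDr mulnDr.
Qed.

(* The exact gradient merges two traces into one of the summed power;
   submultiplicativity of traces splits it again at the cost of the degree. *)
Lemma trace_power_gradient_product_le m ms w :
  rv_eval Y (trace_power_gradient m.+1 (trace_product ms)) w <=
  rv_eval Y (sg m * trace_product ms *+ (2 * trace_degree ms)) w.
Proof.
elim: ms => [|l ms IH]; rewrite /trace_product /trace_degree ?(big_nil, big_cons).
  by rewrite trace_power_gradient1 muln0 mulr0n.
rewrite trace_power_gradientM trace_power_gradient_trace.
rewrite mulnDr mulrnDr /rv_eval !mpoly.mevalD -!/(rv_eval _ _ _) addSn.
apply: lerD.
  rewrite mulrnAl /rv_eval !mpoly.mevalMn -!/(rv_eval _ _ _) ler_wMn2r//.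
  rewrite mulrA !rv_evalM ler_wpM2r ?rv_eval_trace_product_ge0//.
  rewrite !rv_eval_trace_power.
  by have := trace_wishartXD (random_mx w) m.+1 l.+1; rewrite addSn addnS.
rewrite mulrCA -mulrnAr !rv_evalM ler_wpM2l// rv_eval_trace_power.
exact: trace_wishartX_ge0.
Qed.

Lemma trace_product_expectation0 ms :
  EE (trace_product (0%N :: ms)) =
  (p * n + 2 * trace_degree ms)%:R * EE (trace_product ms).
Proof.
rewrite [trace_product _]big_cons -/(trace_product ms).
rewrite trace_power_expectation// mulr0n addr0 trace_power_gradient0_product.
rewrite big_ord1 subnn !expr0 !mxtrace1 -natrM mulr_natl.
by rewrite !poly_expectationMn// -mulrnDr mulr_natl mulnC.
Qed.

(** The non-planar term and the gradient are bounded by multiples of the expectation that already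
    carries [n + p], so they only enlarge its coefficient. Every list on the right has total degree
    one less than the list on the left, which drives the induction. *)
Lemma trace_product_expectationS m ms :
  EE (trace_product (m.+1 :: ms)) <=
  (n + p + m.+1 + 2 * trace_degree ms)%:R * EE (trace_product (m :: ms)) +
  \sum_(i < m) EE (trace_product [:: nat_of_ord i, (m.-1 - i)%N & ms]).
Proof.
rewrite ![trace_product (_ :: ms)]big_cons -!/(trace_product ms).
rewrite trace_power_expectationS//.
have gradE : EE (trace_power_gradient m.+1 (trace_product ms)) <=
    EE (sg m * trace_product ms) *+ (2 * trace_degree ms).
  rewrite -poly_expectationMn//; apply: le_poly_expectation => // w.
  exact: trace_power_gradient_product_le.
apply: le_trans (lerD (lexx _) gradE) _.
rewrite (eq_bigr (fun i : 'I_m =>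
    EE (trace_product [:: nat_of_ord i, (m.-1 - i)%N & ms]))); last first.
  by move=> i _; rewrite /trace_product !big_cons.
move: (EE _) (\sum_(i < m) _) => x y.
by rewrite !natrD !mulrDl !mulr_natl !mulrnDr; lra.
Qed.

End trace_moments.

(** * Growth of the majorant sequence *)

Section catalan_majorant.
Context {R : realType}.
Variables (q s : R).

(* [catalan k] bounds the expected trace of the power [k.+1]; the list of all
   previous values is carried along for the course-of-values recursion. *)
Fixpoint catalan_seq (k : nat) : seq R :=
  if k is j.+1 then
    rcons (catalan_seq j) (s * (catalan_seq j)`_j +
      \sum_(i < j) (catalan_seq j)`_i * (catalan_seq j)`_(j.-1 - i))
  else [:: q].

Definition catalan k : R := (catalan_seq k)`_k.

Let size_catalan_seq k : size (catalan_seq k) = k.+1.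
Proof. by elim: k => //= k IH; rewrite size_rcons IH. Qed.

Let nth_catalan_seq k i : (i <= k)%N -> (catalan_seq k)`_i = catalan i.
Proof.
elim: k => [|k IH]; first by rewrite leqn0 => /eqP ->.
rewrite leq_eqVlt => /predU1P[->//|ik] /=.
by rewrite nth_rcons size_catalan_seq ik IH.
Qed.

Lemma catalan0 : catalan 0 = q. Proof. by []. Qed.

Lemma catalanS k : catalan k.+1 =
  s * catalan k + \sum_(i < k) catalan i * catalan (k.-1 - i).
Proof.
rewrite {1}/catalan /= nth_rcons size_catalan_seq ltnn eqxx -/(catalan k).
congr (_ + _); apply: eq_bigr => i _.
by rewrite !nth_catalan_seq//; have := ltn_ord i; lia.
Qed.

Hypotheses (q0 : 0 <= q) (s0 : 0 <= s).

Lemma catalan_ge0 k : 0 <= catalan k.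
Proof.
elim/ltn_ind: k => -[|k] IH; first by rewrite catalan0.
rewrite catalanS addr_ge0 ?mulr_ge0 ?IH//.
by apply: sumr_ge0 => i _; rewrite mulr_ge0// IH//; have := ltn_ord i; lia.
Qed.

Let shifted_sum_le (f : nat -> R) m j : (forall i, 0 <= f i) ->
  \sum_(i < m | (j < i)%N) f (i.-1 - j)%N <= \sum_(i < m) f i.
Proof.
move=> f0.
have -> : \sum_(i < m | (j < i)%N) f (i.-1 - j)%N = \sum_(i < m - j.+1) f i.
  elim: m => [|m IH]; first by rewrite !big_ord0.
  rewrite big_mkcond big_ord_recr -big_mkcond IH /=; case: ltnP => jm.
    rewrite (_ : (m.+1 - j.+1 = (m - j.+1).+1)%N); last by lia.
    by rewrite big_ord_recr /=; congr (_ + f _); lia.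
  by rewrite addr0 (_ : (m.+1 - j.+1 = m - j.+1)%N)//; lia.
rewrite (big_ord_widen _ f (leq_subr _ m)) big_mkcond.
by apply: ler_sum => i _; case: ifP.
Qed.

(** The index pairs [(j, i.-1 - j)] with [j < i < m] are distinct and lie in the square of side [m],
    over which the right side sums. *)
Let triangular_sum_le (f : nat -> R) m : (forall i, 0 <= f i) ->
  \sum_(i < m) \sum_(j < i) f j * f (i.-1 - j)%N <= (\sum_(i < m) f i) ^+ 2.
Proof.
move=> f0.
under eq_bigr => i _ do
  rewrite (big_ord_widen m (fun j => f j * f (i.-1 - j)%N) (ltnW (ltn_ord i))).
rewrite (exchange_big_dep xpredT)//= expr2 mulr_suml.
apply: ler_sum => j _; rewrite -mulr_sumr ler_wpM2l//.
exact: shifted_sum_le.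
Qed.

(* At [x = 1 / (s + 2 sqrt q)] the quadratic equation
   [A = x (q + s A + A^2)] of the generating function has the double root
   [A = sqrt q], so the partial sums stay below it. *)
Lemma catalan_le k (r := Num.sqrt q) : 0 < q ->
  catalan k <= r * (s + 2 * r) ^+ k.+1.
Proof.
move=> q_gt0; have r0 : 0 < r by rewrite sqrtr_gt0.
have rr : r ^+ 2 = q by rewrite sqr_sqrtr.
set rho := s + 2 * r.
have rho0 : 0 < rho by rewrite ltr_wpDl// mulr_gt0.
pose f i := catalan i / rho ^+ i.+1.
have f0 i : 0 <= f i by rewrite divr_ge0 ?catalan_ge0// exprn_ge0// ltW.
have sum_le m : \sum_(i < m) f i <= r.
  elim: m => [|m IH]; first by rewrite big_ord0 ltW.
  have fS i : f i.+1 = (s * f i + \sum_(j < i) f j * f (i.-1 - j)%N) / rho.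
    rewrite /f catalanS exprSr invfM [LHS]mulrA; congr (_ / _).
    rewrite mulrDl -mulrA; congr (_ + _); rewrite mulr_suml; apply: eq_bigr => j _.
    rewrite mulf_div -exprD; congr (_ / _ ^+ _).
    by have := ltn_ord j; lia.
  rewrite big_ord_recl; under eq_bigr do rewrite lift0 fS.
  rewrite -mulr_suml big_split/= -mulr_sumr {1}/f catalan0 expr1 -mulrDl.
  rewrite ler_pdivrMr//.
  have := @triangular_sum_le f m f0.
  have S0 : 0 <= \sum_(i < m) f i by exact: sumr_ge0.
  move: IH S0; set S := \sum_(i < m) f i; set D := \sum_(i < m) _.
  move=> Sr S0 DS; have sSr : s * S <= s * r by rewrite ler_wpM2l.
  have S2 : S ^+ 2 <= q by rewrite -rr ler_pXn2r// nnegrE ltW.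
  (* Since [q = r^2], this says [r * rho = q + s * r + r^2]: the bound [r] on the partial sums
     reproduces itself. *)
  have -> : r * rho = s * r + 2 * q by rewrite /rho -[in RHS]rr; ring.
  lra.
rewrite -ler_pdivrMr ?exprn_gt0//.
apply: le_trans (sum_le k.+1); rewrite big_ord_recr/= lerDr.
exact: sumr_ge0.
Qed.

End catalan_majorant.

(** * Tail bounds for traces of Wishart powers *)

Section gaussian_matrix_tails.
Context {R : realType} {p n : nat}.
Local Notation N := #|{: 'I_p * 'I_n}|.
Context d (T : measurableType d) (P : probability T R).
Context (Y : 'I_N -> {RV P >-> R}).
Hypothesis Y_indep : mutually_independent Y.
Hypothesis Y_normal : forall i,
  distribution P (Y i) = normal_prob 0 1 :> (set R -> \bar R).
Local Notation EE := (poly_expectation Y).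
Local Notation sg := (@trace_power R p n).
Local Notation S w m := (\tr (wishart (random_mx Y w) ^+ m)).

Lemma measurable_trace_power m : measurable_fun setT (fun w => S w m.+1).
Proof.
rewrite (_ : (fun _ => _) = rv_eval Y (sg m)).
  exact: measurable_rv_eval.
by apply/funext => w; rewrite rv_eval_trace_power.
Qed.

(** Here [K] stays fixed while the degree of the list decreases: the corrections
    [2 * trace_degree ms] and [m.+1 + 2 * trace_degree ms] met on the way never exceed [2 * K] and
    [3 * K], so the same sequence bounds every list. *)
Lemma trace_product_expectation_le (K : nat) (ms : seq nat) :
  (trace_degree ms <= K)%N ->
  EE (trace_product ms) <=
  \prod_(m <- ms) catalan (p * n + 2 * K)%:R (n + p + 3 * K)%:R m.
Proof.
set q : R := _%:R; set s : R := _%:R => msK.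
have b0 m : 0 <= catalan q s m by apply: catalan_ge0; rewrite ler0n.
have [k] := ubnP (trace_degree ms).
elim: k ms msK => // k IH [|[|m] ms] msK; rewrite ltnS => msk.
- by rewrite /trace_product !big_nil poly_expectation1.
- rewrite trace_product_expectation0// big_cons catalan0.
  move: msK msk; rewrite /trace_degree !big_cons -/(trace_degree ms) => msK msk.
  apply: ler_pM => //.
  + exact: trace_product_expectation_ge0.
  + by rewrite ler_nat; lia.
  + by apply: IH; lia.
rewrite big_cons catalanS mulrDl.
apply: le_trans (trace_product_expectationS Y_indep Y_normal m ms) _.
move: msK msk; rewrite /trace_degree !big_cons -/(trace_degree ms) => msK msk.
have degE l : trace_degree (l :: ms) = (l.+1 + trace_degree ms)%N.
  by rewrite /trace_degree big_cons.
apply: lerD.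
  rewrite -mulrA; apply: ler_pM => //.
  - exact: trace_product_expectation_ge0.
  - by rewrite ler_nat; lia.
  - rewrite -(big_cons _ _ m ms xpredT).
    by apply: IH; rewrite degE; lia.
rewrite mulr_suml; apply: ler_sum => i _.
have im := ltn_ord i.
have := IH [:: nat_of_ord i, (m.-1 - i)%N & ms].
rewrite !big_cons mulrA /trace_degree !big_cons -/(trace_degree ms).
by apply; lia.
Qed.

(** In Markov's inequality the [K]-th power of the growth rate cancels, leaving only the prefactor
    [sqrt q] of [catalan_le] against [(1 + eps) ^+ K]. *)
Lemma trace_power_tail (m : nat) (eps : R) (K := m.+1)
    (q : R := (p * n + 2 * K)%:R) (s : R := (n + p + 3 * K)%:R) :
  0 < eps ->
  ((1 - Num.sqrt q / (1 + eps) ^+ K)%:E <=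
   P [set w | (S w K <= ((1 + eps) * (s + 2 * Num.sqrt q)) ^+ K)%R])%E.
Proof.
move=> eps0.
have q0 : 0 < q by rewrite ltr0n; lia.
have s0 : 0 < s by rewrite ltr0n; lia.
have rho0 : 0 < s + 2 * Num.sqrt q by rewrite ltr_pwDl// mulr_ge0.
have a0 : 0 < ((1 + eps) * (s + 2 * Num.sqrt q)) ^+ K.
  by rewrite exprn_gt0// mulr_gt0// addr_gt0.
have sg0 w : 0 <= rv_eval Y (sg m) w.
  by rewrite rv_eval_trace_power trace_wishartX_ge0.
have := poly_markov Y_indep Y_normal sg0 a0.
under [X in P X]eq_set do rewrite rv_eval_trace_power.
apply: le_trans; rewrite lee_fin lerD2l lerN2 exprMn.
have := @trace_product_expectation_le K [:: m].
rewrite /trace_degree /trace_product !big_seq1 => /(_ (leqnn _)) EE_le.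
have X0 : 0 < (1 + eps) ^+ K by rewrite exprn_gt0// addr_gt0.
have Y0 : 0 < (s + 2 * Num.sqrt q) ^+ K by rewrite exprn_gt0.
rewrite ler_pdivrMr ?mulr_gt0// mulrA divfK ?gt_eqF//.
apply: le_trans EE_le _.
by apply: catalan_le => //; rewrite ltW.
Qed.

(** Markov's inequality for the polynomial [(f - c)^2]; the numerator is the second moment about the
    centre [c], expanded by linearity. *)
Lemma poly_chebyshev (f : mpoly.mpoly N R) (c a : R) : 0 < a ->
  ((1 - (EE (f * f) - 2 * c * EE f + c ^+ 2) / a ^+ 2)%:E <=
   P [set w | (`|rv_eval Y f w - c| <= a)%R])%E.
Proof.
move=> a0; pose g : mpoly.mpoly N R := f * f + (- (2 * c)) *: f + c ^+ 2 *: 1.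
have gE w : rv_eval Y g w = (rv_eval Y f w - c) ^+ 2.
  rewrite /g /rv_eval !mpoly.mevalD !mpoly.mevalZ mpoly.meval1 mpoly.mevalM.
  by ring.
have := @poly_markov _ _ _ P _ Y Y_indep Y_normal g (a ^+ 2).
rewrite /g !poly_expectationD// !poly_expectationZ// poly_expectation1 mulr1.
rewrite mulNr => /(_ _ _)/le_trans; apply.
- by move=> w; rewrite gE sqr_ge0.
- by rewrite exprn_gt0.
rewrite le_eqVlt; apply/orP; left; apply/eqP; congr (P _).
apply/funext => w; apply/propext; rewrite /= -/g gE.
by rewrite -real_normK ?num_real// ler_pXn2r// nnegrE ltW.
Qed.

Let trace_product1 m : trace_product [:: m] = sg m.
Proof. by rewrite /trace_product big_seq1. Qed.

Let trace_product2 m l : trace_product [:: m; l] = sg m * sg l.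
Proof. by rewrite /trace_product big_cons big_seq1. Qed.

Lemma expectation_trace0 : EE (sg 0%N) = (p * n)%:R.
Proof.
rewrite -trace_product1 trace_product_expectation0// /trace_degree big_nil.
by rewrite /trace_product big_nil poly_expectation1// muln0 addn0 mulr1.
Qed.

(** The mean is needed exactly for the variance estimate, so it comes from the integration by parts
    identity and not from its majorized form. The planar terms give [n + p], the non-planar one
    gives 1. *)
Lemma expectation_trace1 : EE (sg 1%N) = ((n + p + 1) * (p * n))%:R.
Proof.
rewrite -[sg 1]mulr1 trace_power_expectation// trace_power_gradient1.
rewrite poly_expectation0// addr0 big_ord_recr big_ord1 /= subn0 subnn !expr0.
rewrite !mxtrace1 trace_wishart_dual -!/(sg 0%N) !mulr1 mulr1n.
rewrite poly_expectationD// mulr_natl mulr_natr !poly_expectationMn//.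
rewrite expectation_trace0 [in RHS]natrM; set e : R := (p * n)%:R.
by rewrite !natrD !mulrDl mul1r !mulr_natl.
Qed.

Lemma trace0_tail (eps : R) : 0 < eps -> (0 < p * n)%N ->
  ((1 - 2 / (eps ^+ 2 * (p * n)%:R))%:E <=
   P [set w | (`|S w 1 - (p * n)%:R| <= eps * (p * n)%:R)%R])%E.
Proof.
move=> eps0 pn0; have c0 : 0 < (p * n)%:R :> R by rewrite ltr0n.
have := @poly_chebyshev (sg 0%N) (p * n)%:R (eps * (p * n)%:R).
under [X in P X]eq_set do rewrite rv_eval_trace_power.
move=> /(_ (mulr_gt0 eps0 c0)); apply: le_trans.
rewrite lee_fin lerD2l lerN2 -trace_product2 trace_product_expectation0//.
rewrite /trace_degree big_seq1 trace_product1 expectation_trace0 natrD muln1.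
move: ((p * n)%:R : R) c0 => c c0.
by rewrite le_eqVlt; apply/orP; left; apply/eqP; field; rewrite !gt_eqF.
Qed.

Lemma trace1_tail (eps : R) (c : R := ((n + p + 1) * (p * n))%:R) :
  0 < eps -> (0 < p * n)%N ->
  ((1 - 32 / (eps ^+ 2 * n%:R))%:E <=
   P [set w | (`|S w 2 - c| <= eps * c)%R])%E.
Proof.
move=> eps0 pn0; have c0 : 0 < c by rewrite ltr0n; lia.
have := @poly_chebyshev (sg 1%N) c (eps * c).
under [X in P X]eq_set do rewrite rv_eval_trace_power.
move=> /(_ (mulr_gt0 eps0 c0)); apply: le_trans.
rewrite lee_fin lerD2l lerN2 -trace_product2 expectation_trace1 -/c.
have n0 : (0 < n)%N by lia.
have p0 : (0 < p)%N by lia.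
(* The remaining trace has [trace_degree] 2, which adds 4 to both [n + p + 1] and [p * n]. *)
have E2 : EE (trace_product [:: 1%N; 1%N]) <= ((n + p + 5) * (p * n + 4))%:R * c.
  apply: le_trans (trace_product_expectationS Y_indep Y_normal 0 [:: 1%N]) _.
  rewrite big_ord0 addr0 trace_product_expectation0// /trace_degree big_seq1.
  rewrite trace_product1 expectation_trace1 mulrA -natrM -/c.
  by rewrite ler_wpM2r ?(ltW c0)// ler_nat; nia.
(* The excess is [4 (n + p + 1) + 4 p n + 16]; times [n] it is a bounded multiple of [c] because [n]
   and [p] are at least 1. The constant 32 is not optimized. *)
have W_le : (((n + p + 5) * (p * n + 4))%:R - c) * n%:R <= 32 * c.
  rewrite mulrBl lerBlDr -!natrM -natrD ler_nat; nia.
have -> : 32 / (eps ^+ 2 * n%:R) = (32 * c / n%:R) * c / (eps * c) ^+ 2.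
  by field; rewrite !gt_eqF ?ltr0n.
rewrite ler_wpM2r ?invr_ge0 ?sqr_ge0//.
apply: (@le_trans _ _ ((((n + p + 5) * (p * n + 4))%:R - c) * c)); first by lra.
by rewrite ler_wpM2r ?(ltW c0)// ler_pdivlMr ?ltr0n.
Qed.

End gaussian_matrix_tails.

(** * The semidefinite program *)

Section psd_forms.
Context {R : realType} {p : nat} (X : 'M[R]_p).
Hypothesis psdX : psd X.

(** Allowing matrix arguments of any width lets one Cauchy-Schwarz inequality serve vectors, data
    matrices and powers of [M]. *)
Definition psd_form q (B C : 'M[R]_(p, q)) : R := \tr (B^T *m X *m C).
Local Notation form := psd_form.

Lemma psd_form_ge0 q (B : 'M[R]_(p, q)) : 0 <= form B B.
Proof.
apply: sumr_ge0 => j _; have := psdX.2 (col j B).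
by rewrite tr_col -row_mul colE mulmxA -row_mul -colE mxE [X in _ <= X]mxE.
Qed.

Lemma psd_formC q (B C : 'M[R]_(p, q)) : form B C = form C B.
Proof. by rewrite /form -mxtrace_tr !trmx_mul trmxK psdX.1 mulmxA. Qed.

Lemma psd_formD q (B C : 'M[R]_(p, q)) :
  form (B + C) (B + C) = form B B + 2 * form B C + form C C.
Proof.
have := psd_formC B C; rewrite /form [(B + C)^T]raddfD /= !mulmxDl !mulmxDr !mxtraceD.
by move=> ->; ring.
Qed.

Lemma psd_formZ q a (B C : 'M[R]_(p, q)) : form B (a *: C) = a * form B C.
Proof. by rewrite /form -scalemxAr mxtraceZ. Qed.

Lemma psd_form_cauchy_schwarz q (B C : 'M[R]_(p, q)) :
  form B C ^+ 2 <= form B B * form C C.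
Proof.
have quad (t : R) : 0 <= form B B + 2 * t * form B C + t ^+ 2 * form C C.
  have := psd_form_ge0 (B + t *: C).
  rewrite psd_formD !psd_formZ (psd_formC (t *: C) C) psd_formZ.
  by congr (_ <= _); ring.
have b0 := psd_form_ge0 B; have c0 := psd_form_ge0 C.
have [c_eq0|c_neq0] := eqVneq (form C C) 0; last first.
  have {}c0 : 0 < form C C by rewrite lt_neqAle eq_sym c_neq0.
  rewrite -subr_ge0.
  have := mulr_ge0 (ltW c0) (quad (- form B C / form C C)).
  by congr (_ <= _); field.
rewrite c_eq0 mulr0; have [->|c_neq0] := eqVneq (form B C) 0.
  by rewrite expr0n.
have := quad (- (form B B + 1) / (2 * form B C)); rewrite c_eq0.
rewrite mulr0 addr0.
have -> : form B B + 2 * (- (form B B + 1) / (2 * form B C)) * form B C = - 1.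
  by field.
by rewrite ler0N1.
Qed.

Lemma psd_form_triangle q (B C : 'M[R]_(p, q)) :
  Num.sqrt (form (B + C) (B + C)) <=
  Num.sqrt (form B B) + Num.sqrt (form C C).
Proof.
have b0 := psd_form_ge0 B; have c0 := psd_form_ge0 C.
rewrite -(ler_pXn2r (_ : 0 < 2)%N) ?nnegrE ?addr_ge0 ?sqrtr_ge0//.
rewrite sqrrD !sqr_sqrtr ?psd_form_ge0// psd_formD lerD2r lerD2l.
rewrite mulr_natl ler_wMn2r// -sqrtrM// (le_trans (ler_norm _))//.
by rewrite -sqrtr_sqr ler_wsqrtr// psd_form_cauchy_schwarz.
Qed.

(** It suffices to treat one column [v]. There the form is the sum of [v a 0 * (X *m v) a 0], and
    Cauchy-Schwarz for the form bounds the square of [(X *m v) a 0] by [X a a] times the form at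
    [v]. Summation over [a] gives the trace of [X], and one factor of the form cancels. *)
Lemma psd_form_le q (B : 'M[R]_(p, q)) : form B B <= \tr (B^T *m B) * \tr X.
Proof.
have trX0 : 0 <= \tr X.
  by have := psd_form_ge0 1%:M; rewrite /form trmx1 mul1mx mulmx1.
have Xaa a : form (delta_mx a 0 : 'cV_p) (delta_mx a 0) = X a a.
  rewrite /form trmx_delta -rowE -colE /mxtrace big_ord1.
  by rewrite !mxE.
have vec (v : 'cV[R]_p) : form v v <= \tr (v^T *m v) * \tr X.
  have v0 : 0 <= \tr (v^T *m v).
    by have := trace_mul_tr_ge0 v^T; rewrite trmxK.
  have [f0|f_neq0] := eqVneq (form v v) 0; first by rewrite f0 mulr_ge0.
  have f_gt0 : 0 < form v v by rewrite lt_neqAle eq_sym f_neq0 psd_form_ge0.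
  rewrite -(ler_pM2r f_gt0) -expr2.
  have fE : form v v = \sum_a v a 0 * (X *m v) a 0.
    rewrite /form -mulmxA /mxtrace big_ord1 mxE.
    by apply: eq_bigr => a _; rewrite [_^T _ _]mxE.
  rewrite {1}fE; apply: le_trans (cauchy_schwarz_sum _ _ _) _.
  have -> : \sum_a v a 0 ^+ 2 = \tr (v^T *m v).
    rewrite /mxtrace big_ord1 mxE.
    by apply: eq_bigr => a _; rewrite [_^T _ _]mxE expr2.
  rewrite -mulrA ler_wpM2l// mulr_suml; apply: ler_sum => a _.
  have -> : (X *m v) a 0 = form (delta_mx a 0 : 'cV_p) v.
    by rewrite /form trmx_delta -rowE -row_mul /mxtrace big_ord1 [RHS]mxE.
  by apply: le_trans (psd_form_cauchy_schwarz _ _) _; rewrite Xaa.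
have entry j (Z : 'M[R]_p) :
    \tr ((col j B)^T *m Z *m col j B) = (B^T *m Z *m B) j j.
  rewrite /mxtrace big_ord1 tr_col -row_mul colE mulmxA -row_mul -colE.
  by rewrite mxE [LHS]mxE.
rewrite mulr_suml; apply: ler_sum => j _; have := vec (col j B).
by rewrite /form entry -{1}(mulmx1 (col j B)^T) entry mulmx1.
Qed.

(** Each doubling of the exponent is Cauchy-Schwarz against the identity, whose form is [\tr X = 1].
    At the last exponent the form is that of a half power with itself, at most its squared Frobenius
    norm, which is the trace of the full power. *)
Lemma psd_form_power_le n (G : 'M[R]_(p, n)) (r : nat) (a : R) :
  \tr X = 1 -> 0 <= a ->
  \tr (wishart G ^+ (2 ^ r.+1)) <= a ^+ (2 ^ r.+1) -> form G G <= a.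
Proof.
move=> trX a0 Ga; pose M := wishart G.
have tM j : form (M ^+ j) (M ^+ j) = form 1%:M (M ^+ (j + j)).
  rewrite /form trmx1 mul1mx tr_wishart mxtrace_mulC mulmxA mulmxE -exprD.
  by rewrite -mulmxE mxtrace_mulC.
have step j : form 1%:M (M ^+ j) ^+ 2 <= form 1%:M (M ^+ (j + j)).
  rewrite -tM; apply: le_trans (psd_form_cauchy_schwarz _ _) _.
  by rewrite {1}/form trmx1 mul1mx mulmx1 trX mul1r.
have iter s : form 1%:M M ^+ (2 ^ s.+1) <= form 1%:M (M ^+ (2 ^ s.+1)).
  elim: s => [|s IH]; first by have := step 1%N; rewrite !expr1.
  rewrite expnS mul2n -addnn.
  apply: le_trans (step _); rewrite addnn -muln2 exprM ler_pXn2r//.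
  - by rewrite nnegrE expnS mulnC exprM sqr_ge0.
  - by rewrite nnegrE; apply: le_trans IH; rewrite expnS mulnC exprM sqr_ge0.
have GE : form G G = form 1%:M M.
  by rewrite /form trmx1 mul1mx -mulmxA mxtrace_mulC mulmxA.
rewrite GE; have [f0|f0] := ltP (form 1%:M M) 0; first by rewrite (le_trans (ltW f0)).
rewrite -(ler_pXn2r (_ : 0 < 2 ^ r.+1)%N) ?expn_gt0 ?nnegrE//.
apply: le_trans (iter r) (le_trans _ Ga).
rewrite expnS mul2n -addnn -tM; apply: le_trans (psd_form_le _) _.
by rewrite trX mulr1 tr_wishart mulmxE -exprD.
Qed.

End psd_forms.

(** * Effect of the spike on the objective *)

Section spiked_matrix.
Context {R : realType} {p n : nat}.
Variables (G : 'M[R]_(p, n)) (z : 'cV[R]_p) (u : 'rV[R]_n) (b : R).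
Hypothesis z_unit : \sum_a z a 0 ^+ 2 = 1.
Let Z : 'M[R]_(p, n) := b *: (z *m u).
Local Notation M := (wishart G).

Lemma mxdot_wishart (H : 'M[R]_(p, n)) X :
  mxdot (wishart H) X = psd_form X H H.
Proof.
rewrite /psd_form mxtrace_mulC mulmxA /mxdot /mxtrace.
rewrite exchange_big; apply: eq_bigr => j _; rewrite [RHS]mxE.
apply: eq_bigr => i _; congr (_ * _).
by have /matrixP/(_ j i) := tr_wishart H 1; rewrite !expr1 mxE.
Qed.

Lemma sum_spike_form : \tr (Z^T *m Z) = b ^+ 2 * \sum_i u 0 i ^+ 2.
Proof.
have -> : \tr (Z^T *m Z) = \sum_i \sum_a Z a i ^+ 2.
  apply: eq_bigr => i _; rewrite mxE; apply: eq_bigr => a _.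
  by rewrite [_^T _ _]mxE expr2.
rewrite mulr_sumr; apply: eq_bigr => i _.
under eq_bigr => a _ do rewrite !mxE big_ord1 !exprMn mulrCA.
by rewrite -mulr_suml z_unit mul1r.
Qed.

Lemma spiked_upper (X : 'M[R]_p) (r : nat) (a : R) :
  psd X -> \tr X = 1 -> 0 <= a -> 0 <= b ->
  \tr (M ^+ (2 ^ r.+1)) <= a ^+ (2 ^ r.+1) ->
  mxdot (wishart (G + Z)) X <=
  (Num.sqrt a + b * Num.sqrt (\sum_i u 0 i ^+ 2)) ^+ 2.
Proof.
move=> psdX trX a0 b0 Ma; rewrite mxdot_wishart.
have GZ0 := psd_form_ge0 psdX (G + Z).
rewrite -[leLHS](sqr_sqrtr GZ0) ler_pXn2r ?nnegrE ?addr_ge0 ?mulr_ge0 ?sqrtr_ge0//.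
apply: le_trans (psd_form_triangle psdX G Z) _; apply: lerD.
  by rewrite ler_wsqrtr// (psd_form_power_le psdX trX a0 Ma).
rewrite -{1}(ger0_norm b0) -sqrtr_sqr -sqrtrM ?sqr_ge0// ler_wsqrtr//.
by apply: le_trans (psd_form_le psdX Z) _; rewrite trX mulr1 sum_spike_form.
Qed.

Lemma trace_wishart2 : \tr (M ^+ 2) = \sum_i \sum_j (wishart_dual G) i j ^+ 2.
Proof.
rewrite -trace_wishart_dual expr2 -mulmxE; apply: eq_bigr => i _; rewrite mxE.
apply: eq_bigr => j _; rewrite expr2; congr (_ * _).
by rewrite /wishart_dual -[in RHS](trmxK G) -trmx_mul trmxK [RHS]mxE.
Qed.

Lemma trace_wishart2E : \tr (M ^+ 2) = \sum_a \sum_c M a c ^+ 2.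
Proof.
rewrite expr2 -mulmxE; apply: eq_bigr => a _; rewrite mxE.
apply: eq_bigr => c _; rewrite expr2; congr (_ * _).
by have /matrixP/(_ a c) := tr_wishart G 1; rewrite !expr1 mxE.
Qed.

(** The left side is the inner product of [M] with [z *m z^T], a matrix of Frobenius norm 1; the
    right side is the Frobenius norm of [M]. *)
Lemma sum_projection_le :
  \sum_i (G^T *m z) i 0 ^+ 2 <= Num.sqrt (\tr (M ^+ 2)).
Proof.
have -> : \sum_i (G^T *m z) i 0 ^+ 2 =
    \sum_ac (z ac.1 0 * z ac.2 0) * M ac.1 ac.2.
  rewrite -(pair_bigA _ (fun a c => (z a 0 * z c 0) * M a c)) /=.
  transitivity (\tr ((G^T *m z)^T *m (G^T *m z))).
    rewrite /mxtrace big_ord1 mxE; apply: eq_bigr => i _.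
    by rewrite [_^T _ _]mxE expr2.
  rewrite trmx_mul trmxK -mulmxA (mulmxA G) -/M /mxtrace big_ord1 mxE.
  apply: eq_bigr => a _; rewrite [_^T _ _]mxE mxE mulr_sumr.
  by apply: eq_bigr => c _; ring.
rewrite (le_trans (ler_norm _))// -sqrtr_sqr ler_wsqrtr//.
apply: le_trans (cauchy_schwarz_sum _ _ _) _.
rewrite -(pair_bigA _ (fun a c => M a c ^+ 2)) /= -trace_wishart2E.
rewrite -(pair_bigA _ (fun a c => (z a 0 * z c 0) ^+ 2)) /=.
under eq_bigr do under eq_bigr do rewrite exprMn.
under eq_bigr do rewrite -mulr_sumr z_unit mulr1.
by rewrite z_unit mul1r.
Qed.

(** The objective is the squared Frobenius norm of [G^T *m (G + Z)], whose spike part has rank one.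
    The mixed term is absorbed pointwise by a weighted square inequality, at the cost of a fraction
    [eps] of the main term. *)
Lemma spiked_lower (eps : R) : 0 < eps <= 1 ->
  (1 - eps) * \tr (M ^+ 2) -
  eps^-1 * (b ^+ 2 * Num.sqrt (\tr (M ^+ 2)) * \sum_i u 0 i ^+ 2) <=
  mxdot (wishart (G + Z)) M.
Proof.
move=> /andP[eps0 eps1].
have -> : mxdot (wishart (G + Z)) M =
    \sum_i \sum_j (wishart_dual G i j + b * (G^T *m z) i 0 * u 0 j) ^+ 2.
  rewrite mxdot_wishart /psd_form.
  have -> : (G + Z)^T *m M *m (G + Z) =
      (G^T *m (G + Z))^T *m (G^T *m (G + Z)).
    by rewrite trmx_mul trmxK !mulmxA.
  rewrite mxtrace_mulC trace_mul_tr; apply: eq_bigr => i _; apply: eq_bigr => j _.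
  congr (_ ^+ 2); rewrite mulmxDr mxE; congr (_ + _).
  rewrite /Z -scalemxAr mulmxA [LHS]mxE -mulrA; congr (_ * _).
  by rewrite [LHS]mxE big_ord1.
have pt x y : (1 - eps) * x ^+ 2 - eps^-1 * y ^+ 2 <= (x + y) ^+ 2.
  rewrite -subr_ge0.
  have -> : (x + y) ^+ 2 - ((1 - eps) * x ^+ 2 - eps^-1 * y ^+ 2) =
    eps^-1 * (eps * x + y) ^+ 2 + y ^+ 2 by field; rewrite gt_eqF.
  by apply: addr_ge0; rewrite ?sqr_ge0// mulr_ge0 ?sqr_ge0// invr_ge0 ltW.
apply: (@le_trans _ _ (\sum_i \sum_j ((1 - eps) * wishart_dual G i j ^+ 2 -
    eps^-1 * (b * (G^T *m z) i 0 * u 0 j) ^+ 2))); last first.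
  by do 2 (apply: ler_sum => ? _); exact: pt.
under [leRHS]eq_bigr => i _ do rewrite sumrB -!mulr_sumr.
rewrite sumrB -!mulr_sumr -trace_wishart2 lerD2l lerN2.
rewrite ler_wpM2l ?invr_ge0 ?(ltW eps0)//.
under [leLHS]eq_bigr => i _ do under eq_bigr => j _ do rewrite !exprMn.
under [leLHS]eq_bigr => i _ do rewrite -mulr_sumr.
rewrite -mulr_suml -mulr_sumr ler_wpM2r ?ler_wpM2l ?sqr_ge0//.
- by apply: sumr_ge0 => j _; exact: sqr_ge0.
- exact: sum_projection_le.
Qed.

End spiked_matrix.

(** * The normalized noise covariance as a feasible point *)

Section wishart_test_matrix.
Context {R : realType} {p n : nat} (G : 'M[R]_(p, n)).
Local Notation M := (wishart G).

Lemma psd_wishart : psd M.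
Proof.
split; first by have := tr_wishart G 1; rewrite expr1.
move=> v; rewrite mulmxA -mulmxA -{1}(trmxK G) -trmx_mul mxE.
by apply: sumr_ge0 => i _; rewrite [_^T _ _]mxE -expr2 sqr_ge0.
Qed.

Let wishart_diag_ge0 a : 0 <= M a a.
Proof.
by rewrite mxE; apply: sumr_ge0 => i _; rewrite [_^T _ _]mxE -expr2 sqr_ge0.
Qed.

Let sum_sqr_le (f : 'I_p -> R) : (\sum_a f a) ^+ 2 <= p%:R * \sum_a f a ^+ 2.
Proof.
have := cauchy_schwarz_sum (index_enum 'I_p) (fun=> 1) f.
under eq_bigr do rewrite mul1r; move=> /le_trans; apply.
by rewrite expr1n sumr_const card_ord.
Qed.

(** The diagonal is nonnegative and contributes exactly the trace. Off the diagonal, Cauchy-Schwarz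
    over rows and columns gives [p^2] times the sum of squares, which is [\tr (M ^+ 2)] minus the
    diagonal squares; these sum to at least [(\tr M)^2 / p]. *)
Lemma entry_norm1_wishart_le :
  entry_norm1 M <= \tr M +
    Num.sqrt (p%:R ^+ 2 * \tr (M ^+ 2) - p%:R * (\tr M) ^+ 2).
Proof.
pose h a c := if c == a then 0 else `|M a c|.
have -> : entry_norm1 M = \tr M + \sum_a \sum_c h a c.
  rewrite /entry_norm1 /mxtrace -big_split /=; apply: eq_bigr => a _.
  rewrite (bigD1 a)//= ger0_norm//; congr (_ + _).
  rewrite [RHS](bigD1 a)//= [X in _ = X + _]/h eqxx add0r.
  by apply: eq_bigr => c /negbTE ca; rewrite /h ca.
rewrite lerD2l (le_trans (ler_norm _))// -sqrtr_sqr ler_wsqrtr//.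
apply: le_trans (sum_sqr_le _) _.
apply: (@le_trans _ _ (p%:R * \sum_a (p%:R * \sum_c h a c ^+ 2))).
  by rewrite ler_wpM2l//; apply: ler_sum => a _; exact: sum_sqr_le.
have hE a : \sum_c h a c ^+ 2 = \sum_c M a c ^+ 2 - M a a ^+ 2.
  rewrite [in RHS](bigD1 a)//= [RHS]addrC addKr.
  rewrite (bigD1 a)//= [X in X ^+ 2 + _]/h eqxx expr0n add0r.
  by apply: eq_bigr => c /negbTE ca; rewrite /h ca real_normK ?num_real.
under eq_bigr do rewrite hE.
rewrite -mulr_sumr sumrB -trace_wishart2E mulrA -expr2 mulrBr lerD2l lerN2.
by rewrite expr2 -mulrA ler_wpM2l// sum_sqr_le.
Qed.

Lemma sdp_feasible_wishart (k : nat) :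
  0 < \tr M -> entry_norm1 M <= k%:R * \tr M ->
  sdp_feasible k ((\tr M)^-1 *: M).
Proof.
move=> trM Mk; have [symM posM] := psd_wishart.
split; [split| |].
- by rewrite linearZ /= symM.
- move=> v; rewrite -scalemxAr -scalemxAl mxE mulr_ge0// invr_ge0 ltW//.
- by rewrite mxtraceZ mulVf// gt_eqF.
- have -> : entry_norm1 ((\tr M)^-1 *: M) = (\tr M)^-1 * entry_norm1 M.
    rewrite /entry_norm1 mulr_sumr; apply: eq_bigr => a _.
    rewrite mulr_sumr; apply: eq_bigr => c _.
    by rewrite mxE normrM ger0_norm// invr_ge0 ltW.
  by rewrite mulrC ler_pdivrMr.
Qed.

Lemma mxdotZr (A B : 'M[R]_p) a : mxdot A (a *: B) = a * mxdot A B.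
Proof.
rewrite /mxdot mulr_sumr; apply: eq_bigr => i _; rewrite mulr_sumr.
by apply: eq_bigr => j _; rewrite mxE mulrCA.
Qed.

Lemma mxdotZl (A B : 'M[R]_p) a : mxdot (a *: A) B = a * mxdot A B.
Proof.
rewrite /mxdot mulr_sumr; apply: eq_bigr => i _; rewrite mulr_sumr.
by apply: eq_bigr => j _; rewrite mxE mulrA.
Qed.

End wishart_test_matrix.

(** * Probability estimates and asymptotics *)

Lemma mutually_independent_reindex (R : realType) d (T : measurableType d)
    (P : probability T R) (I J : finType) (f : J -> I) (Y : I -> {RV P >-> R}) :
  injective f -> mutually_independent Y ->
  mutually_independent (fun j => Y (f j)).
Proof.
move=> f_inj Y_indep A B mB.
(* The whole line is a measurable default; the events actually intersected are indexed by the image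
   of [A]. *)
pose B' i := if [pick j | f j == i] is Some j then B j else [set: R].
have B'f j : B' (f j) = B j.
  rewrite /B'; case: pickP => [l /eqP/f_inj ->//|/(_ j)].
  by rewrite eqxx.
have mB' i : measurable (B' i) by rewrite /B'; case: pickP.
have := Y_indep (f @: A)%SET B' mB'.
rewrite big_imset/=; last by move=> ? ? _ _; exact: f_inj.
under eq_bigr do rewrite B'f.
move=> <-; congr (P _); apply/seteqP; split=> w /= Aw.
- by move=> i /= /imsetP[j jA ->]; rewrite B'f; exact: Aw.
- by move=> j /= jA; rewrite -B'f; apply: Aw; exact: imset_f.
Qed.

Lemma probability_setI_ge (R : realType) d (T : measurableType d)
    (P : probability T R) (A B : set T) (a b : R) :
  measurable A -> measurable B -> ((1 - a)%:E <= P A)%E -> ((1 - b)%:E <= P B)%E ->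
  ((1 - (a + b))%:E <= P (A `&` B))%E.
Proof.
move=> mA mB PA PB.
have mAB : measurable (A `&` B) by exact: measurableI.
have fin C : measurable C -> P C \is a fin_num by exact: fin_num_measure.
have : (P (~` (A `&` B)) <= P (~` A) + P (~` B))%E.
  rewrite setCI; apply: measureU2; exact: measurableC.
rewrite !probability_setC//; move: PA PB.
rewrite -(fineK (fin _ mA)) -(fineK (fin _ mB)) -(fineK (fin _ mAB)).
by rewrite -!EFinB -EFinD !lee_fin; lra.
Qed.

Section latent_tails.
Context {R : realType} {d} {T : measurableType d} {P : probability T R}.
Context {n p : nat} (u : 'I_n -> {RV P >-> R}) (xi : 'I_n -> 'I_p -> {RV P >-> R}).
Hypothesis latents : iid_standard_normal_latents u xi.

Definition noise_mx (w : T) : 'M[R]_(p, n) := \matrix_(a, i) xi i a w.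
Definition factor_row (w : T) : 'rV[R]_n := \row_i u i w.

Let noise (k : 'I_#|{: 'I_p * 'I_n}|) :=
  xi (enum_val k).2 (enum_val k).1.
(** The [u i] are arranged as a matrix with one row, so that [|u|^2] is the trace of its Wishart
    matrix and the trace tail applies with [p = 1]. *)
Let factor (k : 'I_#|{: 'I_1 * 'I_n}|) := u (enum_val k).2.

Let noise_indep : mutually_independent noise.
Proof.
have := @mutually_independent_reindex _ _ _ _ _ _
  (fun k : 'I_#|{: 'I_p * 'I_n}| => inr ((enum_val k).2, (enum_val k).1)) _ _ latents.2.
apply=> k l [e2 e1]; apply: enum_val_inj.
by rewrite [LHS]surjective_pairing e1 e2 -surjective_pairing.
Qed.

Let factor_indep : mutually_independent factor.
Proof.
have := @mutually_independent_reindex _ _ _ _ _ _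
  (fun k : 'I_#|{: 'I_1 * 'I_n}| => inl (enum_val k).2) _ _ latents.2.
apply=> k l [e2]; apply: enum_val_inj.
by rewrite [LHS]surjective_pairing [RHS]surjective_pairing e2 !ord1.
Qed.

Let noise_normal k : distribution P (noise k) = normal_prob 0 1 :> (set R -> \bar R).
Proof. exact: (latents.1 (inr ((enum_val k).2, (enum_val k).1))). Qed.

Let factor_normal k : distribution P (factor k) = normal_prob 0 1 :> (set R -> \bar R).
Proof. exact: (latents.1 (inl (enum_val k).2)). Qed.

Let random_mx_noise w : random_mx noise w = noise_mx w.
Proof. by apply/matrixP => a i; rewrite !mxE /noise enum_rankK. Qed.

Let trace_factor w : \tr (wishart (random_mx factor w) ^+ 1) =
  \sum_i factor_row w 0 i ^+ 2.
Proof.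
rewrite expr1 /mxtrace big_ord1 mxE; apply: eq_bigr => i _.
by rewrite [_^T _ _]mxE !mxE /factor enum_rankK expr2.
Qed.

Lemma latent_tails (eps : R) (m : nat) (K := m.+1)
    (q : R := (p * n + 2 * K)%:R) (s : R := (n + p + 3 * K)%:R)
    (c : R := ((n + p + 1) * (p * n))%:R) :
  0 < eps -> (0 < p * n)%N ->
  exists2 A, measurable A &
  ((1 - (Num.sqrt q / (1 + eps) ^+ K + 36 / (eps ^+ 2 * n%:R)))%:E <= P A)%E /\
  forall w, A w ->
  [/\ \tr (wishart (noise_mx w) ^+ K) <= ((1 + eps) * (s + 2 * Num.sqrt q)) ^+ K,
      `|\tr (wishart (noise_mx w)) - (p * n)%:R| <= eps * (p * n)%:R,
      `|\tr (wishart (noise_mx w) ^+ 2) - c| <= eps * c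
    & \sum_i factor_row w 0 i ^+ 2 <= (1 + eps) * n%:R].
Proof.
move=> eps0 pn0; have n0 : (0 < n)%N by case: n pn0; rewrite ?muln0.
have t1 := trace_power_tail noise_indep noise_normal m eps0.
have t2 := trace0_tail noise_indep noise_normal eps0 pn0.
have t3 := trace1_tail noise_indep noise_normal eps0 pn0.
have t4 := trace0_tail factor_indep factor_normal eps0 (_ : 0 < 1 * n)%N.
move: t1 t2 t3 t4; rewrite mul1n -/K -/q -/s -/c => t1 t2 t3 /(_ n0) t4.
have mle (f : T -> R) a : measurable_fun setT f -> measurable [set w | f w <= a].
  by move=> mf; rewrite -[X in measurable X]setTI; apply: measurable_fun_le.
have mdist (f : T -> R) e a : measurable_fun setT f ->
    measurable [set w | `|f w - e| <= a].
  move=> mf; apply: mle; apply: measurableT_comp => //.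
  exact: measurable_funB.
have mN := measurable_trace_power noise_indep noise_normal.
have mF := measurable_trace_power factor_indep factor_normal.
have m1 := mle _ (((1 + eps) * (s + 2 * Num.sqrt q)) ^+ K) (mN m).
have m2 := mdist _ (p * n)%:R (eps * (p * n)%:R) (mN 0).
have m3 := mdist _ c (eps * c) (mN 1).
have m4 := mdist _ n%:R (eps * n%:R) (mF 0).
have m12 := measurableI _ _ m1 m2; have m123 := measurableI _ _ m12 m3.
have t12 := probability_setI_ge m1 m2 t1 t2.
have t123 := probability_setI_ge m12 m3 t12 t3.
have t1234 := probability_setI_ge m123 m4 t123 t4.
apply: (ex_intro2 _ _ _ (measurableI _ _ m123 m4)).
split.
  (* The constant is [36 = 2 + 32 + 2], for the trace, the trace of the square and [|u|^2]; the
     first uses [n <= p * n]. *)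
  apply: le_trans t1234; rewrite lee_fin lerD2l lerN2 -!addrA lerD2l.
  have n_gt0 : 0 < n%:R :> R by rewrite ltr0n.
  have pn_ge : n%:R <= (p * n)%:R :> R.
    by rewrite ler_nat; case: p pn0 => // p' _; rewrite mulSn leq_addr.
  have e2 : 0 < eps ^+ 2 by rewrite exprn_gt0.
  have : 2 / (eps ^+ 2 * (p * n)%:R) <= 2 / (eps ^+ 2 * n%:R).
    rewrite ler_wpM2l// lef_pV2 ?posrE ?mulr_gt0// ?ler_wpM2l ?(ltW e2)//.
    exact: lt_le_trans pn_ge.
  have -> : 36 / (eps ^+ 2 * n%:R) = 2 / (eps ^+ 2 * n%:R) +
      (32 / (eps ^+ 2 * n%:R) + 2 / (eps ^+ 2 * n%:R)) by rewrite -!mulrDl; congr (_ / _); ring.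
  by lra.
move=> w [[[w1 w2] w3] w4]; move: w1 w2 w3 w4 => /=.
rewrite !random_mx_noise trace_factor expr1 => w1 w2 w3 w4; split=> //.
by move: w4; rewrite ler_distl => /andP[_]; lra.
Qed.

End latent_tails.

(** * Deterministic inequalities on the event of good traces *)

Section numeric_bounds.
Context {R : realType}.

(** Since [K >= 1], [(3/2 K)^2] dominates [2 K], so the root exceeds [sqrt p * sqrt n] by at most
    [3/2 K]. The total error is then [3 K + 3 K = 6 K]. *)
Lemma spectral_edge_le (n p K eps : R) : 0 <= n -> 0 <= p -> 1 <= K ->
  6 * K <= eps * n ->
  n + p + 3 * K + 2 * Num.sqrt (p * n + 2 * K) <=
  (1 + eps) * (Num.sqrt n + Num.sqrt p) ^+ 2.
Proof.
move=> n0 p0 K1 Kn.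
have sK : Num.sqrt (p * n + 2 * K) <= Num.sqrt p * Num.sqrt n + 3 / 2 * K.
  have rhs0 : 0 <= Num.sqrt p * Num.sqrt n + 3 / 2 * K.
    by rewrite addr_ge0 ?mulr_ge0//; lra.
  rewrite -(ler_pXn2r (_ : 0 < 2)%N) ?nnegrE ?sqrtr_ge0//.
  rewrite sqr_sqrtr; last by rewrite addr_ge0 ?mulr_ge0//; lra.
  rewrite sqrrD exprMn !sqr_sqrtr//.
  have : 0 <= Num.sqrt p * Num.sqrt n * (3 / 2 * K) by rewrite !mulr_ge0//; lra.
  rewrite -mulr_natl; nra.
have eps0 : 0 <= eps * n by lra.
have := sqr_sqrtr n0; have := sqr_sqrtr p0.
have := sqrtr_ge0 n; have := sqrtr_ge0 p; move: sK.
set x := Num.sqrt n; set y := Num.sqrt p => sK y0 x0 yp xn.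
rewrite mulrDl mul1r.
have : eps * n <= eps * (x + y) ^+ 2.
  have [n_eq0|n_neq0] := eqVneq n 0.
    by move: Kn; rewrite n_eq0 mulr0; lra.
  have n_gt0 : 0 < n by rewrite lt_neqAle eq_sym n_neq0.
  have e0 : 0 <= eps by rewrite -(pmulr_lge0 _ n_gt0).
  by rewrite ler_wpM2l// -xn ler_pXn2r ?nnegrE ?addr_ge0// lerDl.
rewrite sqrrD yp xn -(mulr_natl (x * y)); lra.
Qed.

Lemma upper_numeric (n p a U beta eps : R) : 0 < n -> 0 <= p ->
  0 < eps <= 1 -> 0 <= beta -> 0 <= U -> U <= (1 + eps) * n -> 0 <= a ->
  a <= (1 + eps) * ((1 + eps) * (Num.sqrt n + Num.sqrt p) ^+ 2) ->
  n^-1 * (Num.sqrt a + Num.sqrt beta * Num.sqrt U) ^+ 2 <=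
  (1 + 4 * eps) * (1 + Num.sqrt (p / n) + Num.sqrt beta) ^+ 2.
Proof.
move=> n0 p0 /andP[e0 e1] b0 U0 Un a0 ale.
have sn0 : 0 < Num.sqrt n by rewrite sqrtr_gt0.
have sp0 := sqrtr_ge0 p; have sb0 := sqrtr_ge0 beta.
have e10 : 0 <= 1 + eps by lra.
have sa : Num.sqrt a <= (1 + eps) * (Num.sqrt n + Num.sqrt p).
  have r0 : 0 <= (1 + eps) * (Num.sqrt n + Num.sqrt p).
    by rewrite mulr_ge0// addr_ge0// ltW.
  rewrite -(ger0_norm r0) -sqrtr_sqr ler_wsqrtr// exprMn.
  by rewrite expr2 -mulrA.
have sU : Num.sqrt U <= (1 + eps) * Num.sqrt n.
  have r0 : 0 <= (1 + eps) * Num.sqrt n by rewrite mulr_ge0// ltW.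
  rewrite -(ger0_norm r0) -sqrtr_sqr ler_wsqrtr// exprMn sqr_sqrtr ?(ltW n0)//.
  apply: le_trans Un _; rewrite ler_wpM2r ?(ltW n0)//; nra.
rewrite sqrtrM// sqrtrV ?(ltW n0)//.
have xn : Num.sqrt n ^+ 2 = n by rewrite sqr_sqrtr// ltW.
move: sa sU sn0 sp0 sb0 xn.
have := sqrtr_ge0 a; have := sqrtr_ge0 U.
set x := Num.sqrt n; set y := Num.sqrt p; set B := Num.sqrt beta.
set A := Num.sqrt a; set V := Num.sqrt U.
move=> V0 A0 sa sU x0 y0 B0 xn.
(* Both roots lose the same factor [1 + eps]; its square is at most [1 + 4 * eps] because
   [eps <= 1]. *)
have AB : A + B * V <= (1 + eps) * (x * (1 + y / x + B)).
  have -> : (1 + eps) * (x * (1 + y / x + B)) =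
      (1 + eps) * (x + y) + B * ((1 + eps) * x) by field; rewrite gt_eqF.
  by apply: lerD => //; rewrite ler_wpM2l.
rewrite ler_pdivrMl//.
apply: (@le_trans _ _ (((1 + eps) * (x * (1 + y / x + B))) ^+ 2)).
  rewrite ler_pXn2r ?nnegrE ?(le_trans _ AB)//; first by rewrite addr_ge0 ?mulr_ge0.
  by rewrite addr_ge0 ?mulr_ge0.
rewrite exprMn exprMn xn mulrCA ler_wpM2l ?(ltW n0)// ler_wpM2r ?sqr_ge0//.
nra.
Qed.

(** At the limiting values of [s0] and [s1] the square root is about [p^2 sqrt n], while [k * s0] is
    at least [2 p^2 sqrt n]. The factor 2 absorbs the fluctuations and the diagonal term [s0]. *)
Lemma feasible_numeric (n p k s0 s1 eps : R) : 0 < n -> 0 < p ->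
  0 < eps <= 1 / 10 -> 1 <= n -> n <= 2 * p -> n <= eps ^+ 2 * p ^+ 2 -> 10 <= p ->
  2 * p / Num.sqrt n <= k ->
  `|s0 - p * n| <= eps * (p * n) ->
  `|s1 - (n + p + 1) * (p * n)| <= eps * ((n + p + 1) * (p * n)) ->
  s0 + Num.sqrt (p ^+ 2 * s1 - p * s0 ^+ 2) <= k * s0.
Proof.
move=> n0 p0 /andP[e0 e1] n1 np nep p10 k_ge.
rewrite !ler_distl => /andP[s0l s0u] /andP[s1l s1u].
have x0 : 0 < Num.sqrt n by rewrite sqrtr_gt0.
have xn : Num.sqrt n ^+ 2 = n by rewrite sqr_sqrtr// ltW.
set x := Num.sqrt n in x0 xn k_ge.
have xp : x <= eps * p.
  rewrite -(ler_pXn2r (_ : 0 < 2)%N) ?nnegrE ?(ltW x0)//; last by rewrite mulr_ge0 ?ltW.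
  by rewrite xn exprMn.
have s00 : 0 < s0.
  apply: lt_le_trans s0l; rewrite subr_gt0 gtr_pMl ?mulr_gt0//; lra.
rewrite -lerBrDl; have -> : k * s0 - s0 = (k - 1) * s0 by ring.
have k1 : 2 * p / x - 1 <= k - 1 by rewrite lerD2r.
have px : 1 <= 2 * p / x by rewrite ler_pdivlMr//; nra.
apply: (@le_trans _ _ ((2 * p / x - 1) * ((1 - eps) * (p * n)))); last first.
  apply: ler_pM => //; first by rewrite subr_ge0.
  - by rewrite !mulr_ge0// ?(ltW p0) ?(ltW n0)//; lra.
  - lra.
have -> : (2 * p / x - 1) * ((1 - eps) * (p * n)) =
    (1 - eps) * p * x * (2 * p - x).
  by rewrite -xn; field; rewrite gt_eqF.
have r0 : 0 <= (1 - eps) * p * x * (2 * p - x).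
  by rewrite !mulr_ge0// ?(ltW p0) ?(ltW x0)//; nra.
rewrite -(ger0_norm r0) -sqrtr_sqr ler_wsqrtr//.
(* With [eps <= 1/10], [n <= 2 p] and [p >= 10] the coefficient is at most
   [0.29 * 2 + 1.1 * 1.1 = 1.79]. *)
apply: (@le_trans _ _ (182 / 100 * (p ^+ 4 * n))).
  have pn0 : 0 < p * n by rewrite mulr_gt0.
  have s0sq : ((1 - eps) * (p * n)) ^+ 2 <= s0 ^+ 2.
    have a0 : 0 <= (1 - eps) * (p * n) by rewrite mulr_ge0 ?(ltW pn0)//; lra.
    have al : (1 - eps) * (p * n) <= s0 by rewrite mulrBl mul1r.
    by rewrite ler_pXn2r ?nnegrE// ltW.
  apply: (@le_trans _ _ (p ^+ 2 * ((1 + eps) * ((n + p + 1) * (p * n))) -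
      p * ((1 - eps) * (p * n)) ^+ 2)).
    apply: lerD; last by rewrite lerN2 ler_wpM2l ?(ltW p0).
    by rewrite ler_wpM2l ?sqr_ge0// mulrDl mul1r; lra.
  have -> : p ^+ 2 * ((1 + eps) * ((n + p + 1) * (p * n))) -
      p * ((1 - eps) * (p * n)) ^+ 2 =
      (p ^+ 3 * n) * ((1 + eps) * (n + p + 1) - (1 - eps) ^+ 2 * n) by ring.
  have -> : 182 / 100 * (p ^+ 4 * n) = (p ^+ 3 * n) * (182 / 100 * p) by ring.
  by rewrite ler_wpM2l ?mulr_ge0 ?exprn_ge0 ?(ltW p0) ?(ltW n0)//; nra.
have -> : ((1 - eps) * p * x * (2 * p - x)) ^+ 2 =
    (p ^+ 2 * n) * ((1 - eps) * (2 * p - x)) ^+ 2 by rewrite -xn; ring.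
have -> : 182 / 100 * (p ^+ 4 * n) = (p ^+ 2 * n) * (182 / 100 * p ^+ 2) by ring.
rewrite ler_wpM2l ?mulr_ge0 ?exprn_ge0 ?(ltW p0) ?(ltW n0)//.
(* From [x <= eps * p], with [0.9 * 1.9 = 1.71]; the square of 1.71 exceeds 1.82. *)
have H : 171 / 100 * p <= (1 - eps) * (2 * p - x).
  rewrite -subr_ge0.
  have -> : (1 - eps) * (2 * p - x) - 171 / 100 * p =
    (1 - eps) * (eps * p - x) + (1 / 10 - eps) * (29 / 10 - eps) * p by field.
  by rewrite addr_ge0// !mulr_ge0 ?subr_ge0 ?(ltW p0)//; lra.
apply: (@le_trans _ _ ((171 / 100 * p) ^+ 2)); first by nra.
by rewrite ler_pXn2r ?nnegrE//; nra.
Qed.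

(** The bound on [beta] makes [beta * U] at most [(1 + eps) sqrt (p n)], while [sqrt s1] is at least
    about [p sqrt n]; [eps^4 p >= 4] turns the ratio into [eps^2], so the cross term costs another
    [eps * s1]. The remaining losses combine through [(1 + eps) (1 - 4 eps) <= (1 - 2 eps) (1 -
    eps)]. *)
Lemma lower_numeric (n p s0 s1 U beta eps : R) : 0 < n -> 0 < p ->
  0 < eps <= 1 / 10 -> 4 <= eps ^+ 4 * p ->
  0 <= beta -> beta <= Num.sqrt (p / n) -> 0 <= U -> U <= (1 + eps) * n ->
  `|s0 - p * n| <= eps * (p * n) ->
  `|s1 - (n + p + 1) * (p * n)| <= eps * ((n + p + 1) * (p * n)) ->
  (1 - 4 * eps) * (1 + p / n) <=
  n^-1 * (s0^-1 * ((1 - eps) * s1 - eps^-1 * (beta * Num.sqrt s1 * U))).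
Proof.
move=> n0 p0 /andP[e0 e1] ep b0 bpn U0 Un.
rewrite !ler_distl => /andP[s0l s0u] /andP[s1l s1u].
have pn0 : 0 < p * n by rewrite mulr_gt0.
have c0 : 0 < (n + p + 1) * (p * n) by rewrite mulr_gt0// !addr_gt0.
have s00 : 0 < s0 by nra.
have s10 : 0 < s1 by nra.
have bU : beta * U <= eps ^+ 2 * Num.sqrt s1.
  apply: (@le_trans _ _ (Num.sqrt (p / n) * ((1 + eps) * n))).
    exact: ler_pM.
  have r1 : 0 <= (1 + eps) * n by rewrite mulr_ge0 ?(ltW n0)//; lra.
  rewrite -{1}(ger0_norm r1) -sqrtr_sqr -sqrtrM ?divr_ge0 ?(ltW p0) ?(ltW n0)//.
  rewrite -{1}(ger0_norm (sqr_ge0 eps)) -sqrtr_sqr -sqrtrM ?sqr_ge0//.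
  rewrite ler_wsqrtr//.
  have -> : p / n * ((1 + eps) * n) ^+ 2 = (1 + eps) ^+ 2 * (p * n).
    by field; rewrite gt_eqF.
  rewrite -exprM.
  have s1p : 9 / 10 * (p * (p * n)) <= s1.
    by apply: le_trans s1l; nra.
  apply: (@le_trans _ _ (eps ^+ 4 * (9 / 10 * (p * (p * n))))); last first.
    by rewrite ler_wpM2l ?exprn_ge0 ?(ltW e0).
  have -> : eps ^+ 4 * (9 / 10 * (p * (p * n))) =
     (9 / 10 * (eps ^+ 4 * p)) * (p * n) by ring.
  by rewrite ler_wpM2r ?(ltW pn0)//; nra.
have cross : eps^-1 * (beta * Num.sqrt s1 * U) <= eps * s1.
  rewrite ler_pdivrMl// mulrA -expr2 -{2}(sqr_sqrtr (ltW s10)).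
  rewrite mulrAC (expr2 (Num.sqrt s1)) mulrA ler_wpM2r ?sqrtr_ge0//.
have main : (1 - 2 * eps) * s1 <= (1 - eps) * s1 - eps^-1 * (beta * Num.sqrt s1 * U).
  by lra.
rewrite -ler_pdivrMl ?invr_gt0// invrK -ler_pdivrMl ?invr_gt0// invrK.
apply: le_trans main.
have -> : s0 * (n * ((1 - 4 * eps) * (1 + p / n))) = s0 * ((1 - 4 * eps) * (n + p)).
  by field; rewrite gt_eqF.
apply: (@le_trans _ _ (((1 + eps) * (p * n)) * ((1 - 4 * eps) * (n + p)))).
  have s0u' : s0 <= (1 + eps) * (p * n) by rewrite mulrDl mul1r.
  have r0 : 0 <= (1 - 4 * eps) * (n + p).
    by apply: mulr_ge0; lra.
  by rewrite ler_wpM2r.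
apply: (@le_trans _ _ ((1 - 2 * eps) * ((1 - eps) * ((n + p + 1) * (p * n))))); last first.
  have s1l' : (1 - eps) * ((n + p + 1) * (p * n)) <= s1 by rewrite mulrBl mul1r.
  by rewrite ler_wpM2l//; lra.
have -> : (1 + eps) * (p * n) * ((1 - 4 * eps) * (n + p)) =
  (p * n) * (((1 + eps) * (1 - 4 * eps)) * (n + p)) by ring.
have -> : (1 - 2 * eps) * ((1 - eps) * ((n + p + 1) * (p * n))) =
  (p * n) * (((1 - 2 * eps) * (1 - eps)) * (n + p + 1)) by ring.
rewrite ler_wpM2l ?(ltW pn0)//; apply: ler_pM; nra.
Qed.

End numeric_bounds.

Lemma sample_covarianceE (R : realType) d (T : measurableType d)
    (P : probability T R) (n p : nat) (u : 'I_n -> {RV P >-> R})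
    (xi : 'I_n -> 'I_p -> {RV P >-> R}) (beta : R) (z : 'cV[R]_p) (w : T) :
  sample_covariance u xi beta z w = n%:R^-1 *:
    wishart (noise_mx xi w + Num.sqrt beta *: (z *m factor_row u w)).
Proof.
congr (_ *: _); apply/matrixP => a c; rewrite summxE [RHS]mxE.
apply: eq_bigr => i _; rewrite mxE big_ord1 [_^T 0 c]mxE [_^T i c]mxE.
have E e : sample u xi beta z i w e 0 =
    (noise_mx xi w + Num.sqrt beta *: (z *m factor_row u w)) e i.
  by rewrite !mxE big_ord1 !mxE; ring.
by rewrite !E.
Qed.

(** * Value of the program on the event of good traces *)

Section sdp_value.
Context {R : realType} {n p : nat} (G : 'M[R]_(p, n)) (z : 'cV[R]_p) (u : 'rV[R]_n).
Variables (beta eps : R) (k r : nat).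
Let K := (2 ^ r.+1)%N.
Let Sigma := n%:R^-1 *: wishart (G + Num.sqrt beta *: (z *m u)).
Hypotheses (z_unit : \sum_a z a 0 ^+ 2 = 1)
  (n_gt0 : (0 < n)%N) (p_ge10 : (10 <= p)%N) (n_le2p : (n <= 2 * p)%N)
  (eps_bounds : 0 < eps <= 1 / 10) (n_le : n%:R <= eps ^+ 2 * p%:R ^+ 2)
  (eps_p : 4 <= eps ^+ 4 * p%:R)
  (beta_ge0 : 0 <= beta) (beta_le : beta <= Num.sqrt (p%:R / n%:R))
  (k_ge : 2 * p%:R / Num.sqrt n%:R <= k%:R :> R)
  (K_le : 6 * K%:R <= eps * n%:R)
  (noise_edge : \tr (wishart G ^+ K) <=
     ((1 + eps) * ((n + p + 3 * K)%:R + 2 * Num.sqrt (p * n + 2 * K)%:R)) ^+ K)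
  (noise_trace : `|\tr (wishart G) - (p * n)%:R| <= eps * (p * n)%:R)
  (noise_trace2 : `|\tr (wishart G ^+ 2) - ((n + p + 1) * (p * n))%:R| <=
     eps * ((n + p + 1) * (p * n))%:R)
  (factor_norm : \sum_i u 0 i ^+ 2 <= (1 + eps) * n%:R).

Let nR : 0 < n%:R :> R. Proof. by rewrite ltr0n. Qed.
Let pR : 0 < p%:R :> R. Proof. by rewrite ltr0n (leq_trans _ p_ge10). Qed.
Let u_ge0 : 0 <= \sum_i u 0 i ^+ 2.
Proof. by apply: sumr_ge0 => i _; exact: sqr_ge0. Qed.

Lemma sdp_value_le X : psd X -> \tr X = 1 ->
  mxdot Sigma X <= (1 + 4 * eps) *
    (1 + Num.sqrt (p%:R / n%:R) + Num.sqrt beta) ^+ 2.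
Proof.
move=> psdX trX; have /andP[eps0 eps1] := eps_bounds.
rewrite mxdotZl.
pose a := (1 + eps) * ((n + p + 3 * K)%:R + 2 * Num.sqrt (p * n + 2 * K)%:R).
have a0 : 0 <= a.
  by rewrite mulr_ge0 ?addr_ge0 ?mulr_ge0//; lra.
have := spiked_upper u z_unit psdX trX a0 (sqrtr_ge0 beta) (noise_edge : _ <= a ^+ K).
move=> /(ler_wpM2l (_ : 0 <= n%:R^-1)) le1.
apply: le_trans (le1 _) _; first by rewrite invr_ge0 ltW.
apply: upper_numeric => //; rewrite ?(ltW pR)//; first by lra.
rewrite /a ler_wpM2l//; first by lra.
have -> : (n + p + 3 * K)%:R = n%:R + p%:R + 3 * K%:R :> R by rewrite 2!natrD natrM.
have -> : (p * n + 2 * K)%:R = p%:R * n%:R + 2 * K%:R :> R by rewrite natrD !natrM.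
apply: spectral_edge_le => //; rewrite ?(ltW pR) ?(ltW nR)//.
by rewrite ler1n expn_gt0.
Qed.

Lemma sdp_value_ge X : sdp_solution k Sigma X ->
  (1 - 4 * eps) * (1 + p%:R / n%:R) <= mxdot Sigma X.
Proof.
move=> [_ X_opt]; have /andP[eps0 eps1] := eps_bounds.
have tr2 := noise_trace2; have tr1 := noise_trace.
rewrite !natrM !natrD in tr1 tr2.
have tr0 : 0 < \tr (wishart G).
  move: tr1; rewrite ler_distl => /andP[H _]; apply: lt_le_trans H.
  by rewrite subr_gt0 gtr_pMl ?mulr_gt0//; lra.
have feasible : sdp_feasible k ((\tr (wishart G))^-1 *: wishart G).
  apply: sdp_feasible_wishart => //.
  apply: le_trans (entry_norm1_wishart_le G) _.
  apply: (@feasible_numeric _ n%:R p%:R _ _ _ eps) => //.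
  - by rewrite ler1n.
  - by rewrite -natrM ler_nat.
  - by rewrite (ler_nat _ 10).
apply: le_trans (X_opt _ feasible); rewrite mxdotZl mxdotZr.
have eps01 : 0 < eps <= 1 by lra.
have := spiked_lower G u (Num.sqrt beta) z_unit eps01.
rewrite sqr_sqrtr// => lower.
apply: le_trans (lower_numeric nR pR eps_bounds eps_p beta_ge0 beta_le u_ge0
  factor_norm tr1 tr2) _.
by rewrite ler_wpM2l ?invr_ge0 ?(ltW nR)// ler_wpM2l ?invr_ge0 ?(ltW tr0).
Qed.

End sdp_value.

(** Accuracy [1 / j.+1] is available from some threshold [N j] on. At time [n] the largest [j <= n]
    whose threshold has passed is used; it tends to infinity, so accuracy and failure probability
    vanish together. *)
Lemma diagonal_probability (R : realType) (d : nat -> measure_display)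
    (T : forall n, measurableType (d n)) (P : forall n, probability (T n) R)
    (E : R -> forall n, set (T n)) :
  (forall j : nat, \forall n \near \oo, exists A, [/\ measurable A,
     A `<=` E j.+1%:R^-1 n & ((1 - j.+1%:R^-1)%:E <= P n A)%E]) ->
  exists zeta : nat -> R, zeta n @[n --> \oo] --> (0 : R) /\
    with_probability_tending_to_one P (fun n => E (zeta n) n).
Proof.
pose Q n j := exists A : set (T n), [/\ measurable A,
     A `<=` E j.+1%:R^-1 n & ((1 - j.+1%:R^-1)%:E <= P n A)%E].
move=> EQ.
have {EQ}/choice[N NQ] : forall j, exists N, forall n, (N <= n)%N -> Q n j.
  by move=> j; have [N _ NQ] := EQ j; exists N => n Nn; exact: NQ.
pose J n := \max_(j < n.+1 | (N j <= n)%N) j.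
have J_ge j n : (j <= n)%N -> (N j <= n)%N -> (j <= J n)%N.
  move=> jn Nn.
  exact: (@leq_bigmax_cond _ (fun i : 'I_n.+1 => (N i <= n)%N)
    (fun i => nat_of_ord i) (Ordinal (jn : (j < n.+1)%N))).
have QJ n : (N 0%N <= n)%N -> Q n (J n).
  move=> N0; apply: NQ; rewrite /J.
  have [|i iN ->] := @eq_bigmax_cond _ (fun i : 'I_n.+1 => (N i <= n)%N)
    (fun i => nat_of_ord i).
    by apply/card_gt0P; exists ord0.
  exact: iN.
pose zeta n : R := (J n).+1%:R^-1.
(* The empty set is the default where no good event is known; this can happen only for [n] below
   [N 0]. *)
pose A n := if pselect (Q n (J n)) is left h then sval (cid h) else set0.
have zeta0 : zeta n @[n --> \oo] --> (0 : R).
  apply/cvgrPdist_le => e e0.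
  pose j := Num.truncn e^-1.
  have je : j.+1%:R^-1 <= e.
    rewrite invf_ple ?posrE// ltW//.
    by have /truncn_itv/andP[] : 0 <= e^-1 by rewrite invr_ge0 ltW.
  near=> n; rewrite sub0r normrN ger0_norm ?invr_ge0//.
  apply: le_trans je; rewrite lef_pV2 ?posrE// ler_nat ltnS; apply: J_ge.
  - by near: n; exact: nbhs_infty_ge.
  - by near: n; exact: nbhs_infty_ge.
exists zeta; split=> //; exists A; split.
- move=> n; rewrite /A; case: pselect => // h.
  by case: cid => B [].
- move=> n; rewrite /A; case: pselect => [h|_]; last exact: sub0set.
  by case: cid => B [].
apply: (squeeze_cvge (f := fun n => (1 - zeta n)%:E) (h := cst 1%E)).
- near=> n.
  have QJn : Q n (J n) by apply: QJ; near: n; exact: nbhs_infty_ge.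
  rewrite probability_le1 ?andbT; last first.
    by rewrite /A; case: pselect => // h; case: cid => B [].
  by rewrite /A; case: pselect => // h; case: cid => B [].
- apply: cvg_EFin; first exact: nearW.
  rewrite /comp /= -[X in _ --> X]subr0.
  by apply: cvgB; [exact: cvg_cst|exact: zeta0].
- exact: cvg_cst.
Unshelve. all: by end_near. Qed.

(** * Growth of the dimension and choice of the moment order *)

Section asymptotics.
Context {R : realType}.

(* [2 ^ (power2_sqrt n).+1] is, up to a factor 2, the square root of [n]. *)
Definition power2_sqrt (n : nat) : nat := ((trunc_log 2 n)./2).-1.

Lemma power2_sqrt_bounds n (K := (2 ^ (power2_sqrt n).+1)%N) :
  (4 <= n)%N -> (K ^ 2 <= n)%N /\ (n < 4 * K ^ 2)%N.
Proof.
move=> n4; have t2 : (2 <= trunc_log 2 n)%N by exact: trunc_log_max.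
have h1 : ((power2_sqrt n).+1 = (trunc_log 2 n)./2)%N.
  rewrite /power2_sqrt prednK//; move: t2; rewrite -{1}(odd_double_half (trunc_log 2 n)).
  by case: (odd _); case: (_./2).
have tP := trunc_logP (isT : 1 < 2)%N (leq_trans (isT : 0 < 4)%N n4).
have tL := trunc_log_ltn n (isT : 1 < 2)%N.
have td := odd_double_half (trunc_log 2 n).
rewrite /K h1 -expnM muln2; split.
  by apply: leq_trans tP; rewrite leq_exp2l// -{2}td leq_addl.
apply: leq_trans tL _; rewrite (_ : 4 = 2 ^ 2)%N// -expnD leq_exp2l//.
by rewrite -{1}td; case: (odd _); lia.
Qed.

(** The numerator is a polynomial in [K] of degree [2 * a]; the exponential is bounded below by its
    Taylor term of degree [2 * a + 1], leaving one power of [K] to beat the constant. *)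
Lemma geometric_dominates (eps delta : R) (a : nat) : 0 < eps -> 0 < delta ->
  exists B : R, forall K : nat, B <= K%:R ->
    3 * (4 * K%:R ^+ 2) ^+ a / (1 + eps) ^+ K <= delta :> R.
Proof.
move=> eps0 delta0.
have l0 : 0 < ln (1 + eps) by rewrite ln_gt0// ltrDl.
set l := ln (1 + eps) in l0.
pose b := (2 * a).+1.
have f0 : 0 < b`!%:R :> R by rewrite ltr0n fact_gt0.
pose C : R := 3 * 4 ^+ a * b`!%:R / l ^+ b.
have C0 : 0 < C by rewrite !mulr_gt0// ?exprn_gt0// invr_gt0 exprn_gt0.
exists (C / delta + 1) => K BK.
have K0 : 0 < K%:R :> R.
  by apply: lt_le_trans BK; rewrite ltr_wpDl// divr_ge0// ltW.
have CK : C <= delta * K%:R.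
  by rewrite -ler_pdivrMl// mulrC; apply: le_trans BK; rewrite lerDl.
have -> : (1 + eps) ^+ K = expR (l * K%:R).
  by rewrite expRM_natr lnK// posrE addr_gt0.
rewrite ler_pdivrMr ?expR_gt0//.
have lK : 0 <= l * K%:R by rewrite mulr_ge0// ltW.
have H : (l * K%:R) ^+ b / b`!%:R <= expR (l * K%:R).
  by apply: le_trans (expR_ge1Dxn (2 * a) lK); rewrite lerDr.
apply: (@le_trans _ _ (delta * ((l * K%:R) ^+ b / b`!%:R))); last first.
  by rewrite ler_wpM2l// ltW.
have lb0 : 0 < l ^+ b by rewrite exprn_gt0.
have -> : 3 * (4 * K%:R ^+ 2) ^+ a = C * (K%:R ^+ (2 * a) * (l ^+ b / b`!%:R)).
  rewrite exprMn -exprM /C; field.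
  by rewrite !gt_eqF.
have -> : delta * ((l * K%:R) ^+ b / b`!%:R) =
    delta * K%:R * (K%:R ^+ (2 * a) * (l ^+ b / b`!%:R)).
  by rewrite exprMn [K%:R ^+ b]exprS; field; rewrite gt_eqF.
by rewrite ler_wpM2r// !mulr_ge0 ?exprn_ge0 ?invr_ge0 ?(ltW K0) ?(ltW l0) ?(ltW f0).
Qed.

Variables (c alpha : R) (p : nat -> nat).
Hypotheses (c_ge1 : 1 <= c) (alpha_ge1 : 1 <= alpha)
  (p_rate : (p n)%:R / (n%:R `^ alpha) @[n --> \oo] --> c).

Lemma near_le2p : \forall n \near \oo, (n <= 2 * p n)%N.
Proof.
have half : 1 / 2 < c by have := c_ge1; lra.
near=> n.
have n1 : 1 <= n%:R :> R by near: n; exact: nbhs_infty_ger.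
have : 1 / 2 < (p n)%:R / (n%:R `^ alpha).
  by near: n; apply: (cvgr_gt c).
have na : n%:R <= n%:R `^ alpha :> R.
  by rewrite -{1}(powRr1 (le_trans ler01 n1)) ler_powR.
have na0 : 0 < n%:R `^ alpha :> R by apply: lt_le_trans na; exact: lt_le_trans n1.
rewrite ltr_pdivlMr// => H; rewrite -(ler_nat R) natrM; lra.
Unshelve. all: by end_near. Qed.

Lemma near_le_power : exists L : nat, \forall n \near \oo, (p n <= n ^ L)%N.
Proof.
(* One power of [n] beyond an integer bound on [alpha] absorbs the constant [c + 1]. *)
pose a := Num.bound alpha; exists a.+1.
near=> n.
have n1 : 1 <= n%:R :> R by near: n; exact: nbhs_infty_ger.
have nc : c + 1 <= n%:R :> R by near: n; exact: nbhs_infty_ger.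
have : (p n)%:R / (n%:R `^ alpha) < c + 1.
  by near: n; apply: (cvgr_lt c) => //; rewrite ltrDl.
have na0 : 0 < n%:R `^ alpha :> R by rewrite powR_gt0// (lt_le_trans ltr01).
have na : n%:R `^ alpha <= n%:R ^+ a :> R.
  rewrite -powR_mulrn// ler_powR// ltW//.
  by apply: le_lt_trans (archi_boundP _); [|exact: le_trans alpha_ge1].
rewrite ltr_pdivrMr// => /ltW H.
rewrite -(ler_nat R) natrX exprS; apply: le_trans H _.
by apply: ler_pM => //; have := c_ge1; lra.
Unshelve. all: by end_near. Qed.

(** With [p n <= n ^ L] and [K <= n], the radicand is at most [3 * n ^ L.+1], and [n < 4 * K ^ 2]
    makes this polynomial in [K]. The square root is simply bounded by its radicand. *)
Lemma near_edge_tail (eps delta : R) : 0 < eps -> 0 < delta ->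
  \forall n \near \oo, let K := (2 ^ (power2_sqrt n).+1)%N in
  Num.sqrt (p n * n + 2 * K)%:R / (1 + eps) ^+ K <= delta.
Proof.
move=> eps0 delta0; have [L pL] := near_le_power.
have [B HB] := geometric_dominates L.+1 eps0 delta0.
near=> n; pose K := (2 ^ (power2_sqrt n).+1)%N; rewrite -/K.
have n4 : (4 <= n)%N by near: n; exact: nbhs_infty_ge.
have [K2 nK] := power2_sqrt_bounds n4; rewrite -/K in K2 nK.
have K0 : (0 < K)%N by rewrite expn_gt0.
have pn : (p n <= n ^ L)%N by near: n.
have BK : B <= K%:R.
  have : 4 * B ^+ 2 <= n%:R by near: n; exact: nbhs_infty_ger.
  have nKR : n%:R <= 4 * K%:R ^+ 2 :> R by rewrite -natrX -natrM ler_nat ltnW.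
  move=> /le_trans/(_ nKR); rewrite ler_pM2l// => B2.
  apply: le_trans (ler_norm B) _.
  by rewrite -(ler_pXn2r (_ : 0 < 2)%N) ?nnegrE// real_normK ?num_real.
apply: le_trans (HB K BK).
rewrite ler_wpM2r ?invr_ge0 ?exprn_ge0 ?addr_ge0 ?(ltW eps0)//.
set q := (p n * n + 2 * K)%N.
have q1 : (1 <= q)%N by rewrite /q; lia.
apply: (@le_trans _ _ q%:R).
  rewrite -{2}(ger0_norm (ler0n R q)) -sqrtr_sqr ler_wsqrtr//.
  by rewrite -natrX ler_nat; nia.
rewrite -natrX -natrM -natrX -natrM ler_nat.
have Kn : (K <= n)%N by nia.
have nL : (n <= n ^ L.+1)%N by rewrite expnS leq_pmulr// expn_gt0; lia.
apply: (@leq_trans (3 * n ^ L.+1)); last by rewrite leq_mul2l /= leq_exp2r// ltnW.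
have : (p n * n <= n ^ L.+1)%N by rewrite expnSr leq_mul2r pn orbT.
by rewrite /q; lia.
Unshelve. all: by end_near. Qed.

End asymptotics.

Theorem theorem1p4 (R : realType) (c alpha : R)
    (p k : nat -> nat) (beta : nat -> R) (z : forall n, 'cV[R]_(p n))
    (d : nat -> measure_display) (T : forall n, measurableType (d n))
    (P : forall n, probability (T n) R)
    (u : forall n, 'I_n -> {RV (P n) >-> R})
    (xi : forall n, 'I_n -> 'I_(p n) -> {RV (P n) >-> R})
    (c_ge1 : 1 <= c) (alpha_ge1 : 1 <= alpha)
    (p_oo : p n @[n --> \oo] --> \oo) (k_oo : k n @[n --> \oo] --> \oo)
    (p_rate : (p n)%:R / (n%:R `^ alpha) @[n --> \oo] --> c)
    (beta_gt0 : \forall n \near \oo, 0 < beta n)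
    (beta_le : \forall n \near \oo, beta n <= Num.sqrt ((p n)%:R / n%:R))
    (k_ge : \forall n \near \oo, 2 * (p n)%:R / Num.sqrt n%:R <= (k n)%:R :> R)
    (k_small : ((k n)%:R / (p n)%:R : R) @[n --> \oo] --> (0 : R))
    (z_spike : \forall n \near \oo, is_spike (k n) (z n))
    (latents : \forall n \near \oo, iid_standard_normal_latents (@u n) (@xi n)) :
  exists zeta : nat -> R,
    zeta n @[n --> \oo] --> (0 : R) /\
    with_probability_tending_to_one P (fun n => [set w |
      let Sigma := sample_covariance (@u n) (@xi n) (beta n) (z n) w in
      forall X : 'M[R]_(p n), sdp_solution (k n) Sigma X ->
        (1 - zeta n) * (1 + (p n)%:R / n%:R) <= mxdot Sigma X /\
        mxdot Sigma X <=
          (1 + zeta n) *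
          (1 + Num.sqrt ((p n)%:R / n%:R) + Num.sqrt (beta n)) ^+ 2]).
Proof.
(* The event is abstracted over the accuracy, so that from here on [delta] is fixed and only [n]
   varies. *)
apply: (@diagonal_probability R d T P (fun zeta n => [set w |
  let Sigma := sample_covariance (@u n) (@xi n) (beta n) (z n) w in
  forall X : 'M[R]_(p n), sdp_solution (k n) Sigma X ->
    (1 - zeta) * (1 + (p n)%:R / n%:R) <= mxdot Sigma X /\
    mxdot Sigma X <=
      (1 + zeta) * (1 + Num.sqrt ((p n)%:R / n%:R) + Num.sqrt (beta n)) ^+ 2])).
move=> j.
pose delta : R := j.+1%:R^-1.
have delta0 : 0 < delta by rewrite invr_gt0.
have delta1 : delta <= 1 by rewrite invf_le1// ler1n.
have [eps [eps0 eps_bounds eps_delta]] :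
    exists e : R, [/\ 0 < e, 0 < e <= 1 / 10 & 4 * e <= delta].
  (* Since [delta <= 1], this choice meets both the bound [1 / 10] of the numeric estimates and the
     final loss [4 * eps]. *)
  exists (delta / 10); have e0 : 0 < delta / 10 by rewrite divr_gt0.
  by split=> //; [rewrite e0 ler_pM2r ?invr_gt0|lra].
have pB (B : R) : \forall n \near \oo, B <= (p n)%:R.
  exact: p_oo (nbhs_infty_ger B).
have le2p := near_le2p c_ge1 alpha_ge1 p_rate.
have edge_tail := near_edge_tail c_ge1 alpha_ge1 p_rate eps0
  (divr_gt0 delta0 (ltr0Sn R 1)).
near=> n.
have n4 : (4 <= n)%N by near: n; exact: nbhs_infty_ge.
have n0 : (0 < n)%N by exact: leq_trans n4.
have nR : 0 < n%:R :> R by rewrite ltr0n.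
have p10 : (10 <= p n)%N by rewrite -(ler_nat R); near: n; exact: pB.
have pR : 0 < (p n)%:R :> R by rewrite ltr0n (leq_trans _ p10).
have n2p : (n <= 2 * p n)%N by near: n.
have epsp : 4 <= eps ^+ 4 * (p n)%:R.
  by rewrite mulrC -ler_pdivrMr ?exprn_gt0//; near: n; exact: pB.
have eps2p : 2 <= eps ^+ 2 * (p n)%:R.
  by rewrite mulrC -ler_pdivrMr ?exprn_gt0//; near: n; exact: pB.
have np : n%:R <= eps ^+ 2 * (p n)%:R ^+ 2.
  have : n%:R <= 2 * (p n)%:R :> R by rewrite -natrM ler_nat.
  by move=> /le_trans; apply; rewrite expr2 mulrA ler_wpM2r// ltW.
pose K := (2 ^ (power2_sqrt n).+1)%N.
have [K2 _] := power2_sqrt_bounds n4; rewrite -/K in K2.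
have K0 : (0 < K)%N by rewrite expn_gt0.
(* Squaring and using [K ^ 2 <= n], it is enough that [n] exceeds [36 / eps ^+ 2]. *)
have Kn : 6 * K%:R <= eps * n%:R.
  have H : 36 / eps ^+ 2 <= n%:R by near: n; exact: nbhs_infty_ger.
  rewrite -(ler_pXn2r (_ : 0 < 2)%N) ?nnegrE ?mulr_ge0 ?(ltW eps0)//.
  rewrite !exprMn; apply: (@le_trans _ _ (36 * n%:R)).
    have -> : 6 ^+ 2 = 36 :> R by ring.
    by rewrite ler_wpM2l// -natrX ler_nat.
  rewrite [n%:R ^+ 2]expr2 mulrA ler_wpM2r ?(ltW nR)//.
  by rewrite mulrC -ler_pdivrMr ?exprn_gt0.
have edge : Num.sqrt (p n * n + 2 * K)%:R / (1 + eps) ^+ K <= delta / 2.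
  by rewrite /K; near: n; exact: edge_tail.
have tail : 36 / (eps ^+ 2 * n%:R) <= delta / 2.
  have H : 36 / eps ^+ 2 / (delta / 2) <= n%:R by near: n; exact: nbhs_infty_ger.
  rewrite invfM mulrA ler_pdivrMr// [leRHS]mulrC -ler_pdivrMr ?divr_gt0//.
have b0 : 0 < beta n by near: n.
have bp : beta n <= Num.sqrt ((p n)%:R / n%:R) by near: n.
have kp : 2 * (p n)%:R / Num.sqrt n%:R <= (k n)%:R :> R by near: n.
have [z_unit _ _] : is_spike (k n) (z n) by near: n.
have lat : iid_standard_normal_latents (@u n) (@xi n) by near: n.
have pn0 : (0 < p n * n)%N by rewrite muln_gt0 n0 andbT -(ltr0n R).
have [A mA []] := latent_tails lat K.-1 eps0 pn0.
rewrite prednK// => PA AE; exists A; split=> //; last first.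
  apply: le_trans PA; rewrite lee_fin lerD2l lerN2 -/delta.
  by apply: le_trans (lerD edge tail) _; lra.
move=> w /AE[w1 w2 w3 w4] /= X; rewrite sample_covarianceE => X_sol.
have [[psdX trX _] _] := X_sol.
rewrite -/delta; split.
- apply: le_trans (sdp_value_ge z_unit n0 p10 n2p eps_bounds np epsp (ltW b0)
    bp kp w2 w3 w4 X_sol).
  by rewrite ler_wpM2r ?addr_ge0 ?divr_ge0//; have := eps_delta; rewrite -/delta; lra.
- apply: le_trans (sdp_value_le z_unit n0 eps_bounds (ltW b0) Kn w1 w4
    psdX trX) _.
  by rewrite ler_wpM2r ?sqr_ge0//; have := eps_delta; rewrite -/delta; lra.
Unshelve. all: by end_near.
Qed.
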